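(* Let $\Gamma$ be a gain operator on $\ell^\infty_+(\mathcal I)$ with $|\mathcal I|<\infty$, and assume the functions $\mu_i$ are uniformly continuous. Then the following are equivalent: (a) there is $\rho\in\mathcal K_\infty$ such that $\Gamma_\rho$ satisfies the NJI condition; (b) there is $\rho\in\mathcal K_\infty$ such that $\Gamma_\rho$ satisfies the uniform NJI condition; (c) there is $\rho\in\mathcal K_\infty$ such that $\Gamma_\rho$ satisfies the $\oplus$-MBI property; (d) there exists a path of strict decay for $\Gamma$; (e) there is $\rho\in\mathcal K_\infty$ such that $\Sigma(\Gamma_\rho)$ is UGAS.
   Context: Let $\mathcal I$ be a nonempty countable index set; $\ell^\infty_+(\mathcal I)$ is the cone of nonnegative real families $s=(s_i)_{i\in\mathcal I}$ with $\|s\|:=\sup_i|s_i|<\infty$, ordered componentwise; $s>0$ means $s\ge0$, $s\ne0$; $\mathbf 1$ is the all-ones vector; $\oplus$ is the componentwise maximum. $\mathcal K$: continuous strictly increasing $\gamma:\mathbb R_+\to\mathbb R_+$ with $\gamma(0)=0$; $\mathcal K_\infty$: unbounded elements of $\mathcal K$, acting componentwise; $\mathcal{KL}$: continuous $\beta$ with $\beta(\cdot,t)\in\mathcal K$ and $\beta(r,\cdot)$ continuous strictly decreasing to $0$ for $r>0$. For $\mathcal J\subset\mathcal I$, $s_{|\mathcal J}$ agrees with $s$ on $\mathcal J$ and is $0$ elsewhere. Gain operator: for each $i$ a finite (possibly empty) $\mathcal I_i\subset\mathcal I\setminus\{i\}$; directed graph $\mathcal G$ with vertices $\mathcal I$ and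 edges $ji$, $j\in\mathcal I_i$; a pointwise equicontinuous family $\gamma_{ij}\in\mathcal K_\infty$ ($ji\in E(\mathcal G)$); functions $\mu_i:\ell^\infty_+(\mathcal I)\to[0,\infty]$ with (M1) some $\xi\in\mathcal K_\infty$ has $\mu_i(0)=0$, $\mu_i(s)\ge\xi(\|s\|)$; (M2) $\mu_i$ monotone; (M3) for each finite $\mathcal J$, $\mu_i$ restricted to vectors vanishing off $\mathcal J$ is finite-valued and continuous; (M4) for each norm-bounded $A$ and $\varepsilon>0$ there is $\delta>0$ with $\sup_i|\mu_i(s_{|\mathcal I_i})-\mu_i(s^0_{|\mathcal I_i})|\le\varepsilon$ whenever $s^0\in A$, $\|s-s^0\|\le\delta$. $\Gamma_i(s):=\mu_i([\gamma_{ij}(s_j)]_{j\in\mathcal I_i})$ (argument zero outside $\mathcal I_i$). $\Gamma_\rho:=(\mathrm{id}+\rho)\circ\Gamma$. $\mathcal N^-_i(n)$: vertices $j$ with a directed path from $j$ to $i$ of length at most $n$ ($\mathcal N^-_i(0)=\{i\}$). For monotone $T$: NJI condition: $T(s)\ge s$ fails for all $s>0$; uniform NJI condition: for all $r,\varepsilon>0$ there are $n\in\mathbb N$, $\delta>0$ such that for all $s$, $i$ with $s_i\ge\varepsilon$, $\|s\|\le r$ there is $j\in\mathcal N^-_i(n)$ with $s_j\ge\delta$, $T_j(s)<s_j$; $\oplus$-MBI property: there is $\varphi\in\mathcal K_\infty$ with $s\le b\oplus T(s)\Rightarrow\|s\|\le\varphi(\|b\|)$ for all $s,b$; $\Sigma(T)$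 is the system $s^{n+1}=T(s^n)$, UGAS if $\|T^n(s)\|\le\beta(\|s\|,n)$ for some $\beta\in\mathcal{KL}$. A path of strict decay for $\Gamma$ is a map $\sigma:\mathbb R_+\to\ell^\infty_+(\mathcal I)$ such that: (i) for some $\rho\in\mathcal K_\infty$, $\Gamma_\rho(\sigma(r))\le\sigma(r)$ for all $r\ge0$; (ii) $\varphi_{\min}(r)\mathbf 1\le\sigma(r)\le\varphi_{\max}(r)\mathbf 1$ for some $\varphi_{\min},\varphi_{\max}\in\mathcal K_\infty$; (iii) each $\sigma_i\in\mathcal K_\infty$; (iv) for each compact $K\subset(0,\infty)$ there are $0<l\le L$ with $l|r_1-r_2|\le|\sigma_i^{-1}(r_1)-\sigma_i^{-1}(r_2)|\le L|r_1-r_2|$ for all $r_1,r_2\in K$, $i\in\mathcal I$. *)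

(* Defs.v *)
From HB Require Import structures.
From mathcomp Require Import all_boot all_order all_algebra.
From mathcomp Require Import all_classical all_reals all_analysis.
Set Implicit Arguments. Unset Strict Implicit. Unset Printing Implicit Defensive.
Import Order.TTheory GRing.Theory Num.Theory.
Import numFieldNormedType.Exports.
Local Open Scope ring_scope.
Local Open Scope classical_set_scope.

Section Defs.
Variables (R : realType) (I : finType).

Definition vnorm (s : I -> R) : R := \big[Num.max/0]_(i : I) `|s i|.
Definition nonneg (s : I -> R) : Prop := forall i, 0 <= s i.
Definition vle (s t : I -> R) : Prop := forall i, s i <= t i.
Definition vpos (s : I -> R) : Prop := nonneg s /\ exists i, s i != 0.
Definition vmax (s t : I -> R) : I -> R := fun i => Num.max (s i) (t i).
Definition vsub (s t : I -> R) : I -> R := fun i => s i - t i.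
Definition restr (J : {set I}) (s : I -> R) : I -> R :=
  fun i => if i \in J then s i else 0.

Definition cont0 (f : R -> R) : Prop :=
  forall x, 0 <= x -> forall e, 0 < e -> exists2 d, 0 < d &
    forall y, 0 <= y -> `|y - x| < d -> `|f y - f x| < e.
Definition classK (f : R -> R) : Prop :=
  [/\ cont0 f, (forall x y, 0 <= x -> x < y -> f x < f y) & f 0 = 0].
Definition classKinf (f : R -> R) : Prop :=
  classK f /\ (forall M, exists2 r, 0 <= r & M < f r).
Definition classKL (b : R -> R -> R) : Prop :=
  [/\
      (forall r t, 0 <= r -> 0 <= t -> forall e, 0 < e -> exists2 d, 0 < d &
         forall r' t', 0 <= r' -> 0 <= t' -> `|r' - r| < d -> `|t' - t| < d ->
           `|b r' t' - b r t| < e),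
      (forall t, 0 <= t -> classK (fun r => b r t)) &
      (forall r, 0 < r ->
         [/\ cont0 (b r),
             (forall t t', 0 <= t -> t < t' -> b r t' < b r t) &
             (forall e, 0 < e -> exists T, forall t, T <= t -> b r t < e)])].

(* edges j -> i for j \in Ii i ; Nin Ii i n j : there is a directed path
   from j to i of length at most n *)
Fixpoint Nin (Ii : I -> {set I}) (i : I) (n : nat) (j : I) : Prop :=
  match n with
  | 0 => j = i
  | n'.+1 => Nin Ii i n' j \/ exists k, j \in Ii k /\ Nin Ii i n' k
  end.

Section Gain.
Variables (Ii : I -> {set I}) (g : I -> I -> R -> R) (mu : I -> (I -> R) -> \bar R).

Definition M1 : Prop :=
  exists2 xi, classKinf xi & forall i, mu i (fun _ => 0) = 0%E /\
    forall s, nonneg s -> ((xi (vnorm s))%:E <= mu i s)%E.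
Definition M2 : Prop :=
  forall i s t, nonneg s -> vle s t -> (mu i s <= mu i t)%E.
Definition M3 : Prop :=
  forall i (J : {set I}),
    let D := fun s : I -> R => nonneg s /\ forall j, j \notin J -> s j = 0 in
    (forall s, D s -> mu i s \is a fin_num) /\
    (forall s0, D s0 -> forall e, 0 < e -> exists2 d, 0 < d &
       forall s, D s -> vnorm (vsub s s0) < d ->
         `|fine (mu i s) - fine (mu i s0)| < e).
Definition M4 : Prop :=
  forall A : set (I -> R), (forall s, A s -> nonneg s) ->
    (exists r, forall s, A s -> vnorm s <= r) ->
    forall e, 0 < e -> exists2 d, 0 < d &
      forall s0 s, A s0 -> nonneg s -> vnorm (vsub s s0) <= d ->
        forall i, `|fine (mu i (restr (Ii i) s)) - fine (mu i (restr (Ii i) s0))| <= e.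

Definition is_gain_operator : Prop :=
  [/\ forall i, i \notin Ii i,
      forall i j, j \in Ii i -> classKinf (g i j),
      (forall r, 0 <= r -> forall e, 0 < e -> exists2 d, 0 < d &
         forall i j, j \in Ii i -> forall r', 0 <= r' -> `|r' - r| < d ->
           `|g i j r' - g i j r| < e),
      M1 /\ M2 & M3 /\ M4].

(* Gamma_i(s) = mu_i([g_ij(s_j)]_{j in Ii}) ; values finite by (M3) *)
Definition Gam (s : I -> R) : I -> R :=
  fun i => fine (mu i (fun j => if j \in Ii i then g i j (s j) else 0)).

End Gain.

Definition unif_cont (m : (I -> R) -> \bar R) : Prop :=
  forall e, 0 < e -> exists2 d, 0 < d &
    forall s s', nonneg s -> nonneg s' -> vnorm (vsub s s') <= d ->
      `|fine (m s) - fine (m s')| <= e.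

Definition Gam_rho (G : (I -> R) -> I -> R) (rho : R -> R) (s : I -> R) : I -> R :=
  fun i => G s i + rho (G s i).

Definition NJI (T : (I -> R) -> I -> R) : Prop :=
  forall s, vpos s -> ~ vle s (T s).
Definition uNJI (Ii : I -> {set I}) (T : (I -> R) -> I -> R) : Prop :=
  forall r e, 0 < r -> 0 < e -> exists n : nat, exists2 d, 0 < d &
    forall s i, nonneg s -> e <= s i -> vnorm s <= r ->
      exists j, [/\ Nin Ii i n j, d <= s j & T s j < s j].
Definition oplus_MBI (T : (I -> R) -> I -> R) : Prop :=
  exists2 phi, classKinf phi & forall s b, nonneg s -> nonneg b ->
    vle s (vmax b (T s)) -> vnorm s <= phi (vnorm b).
Definition UGAS (T : (I -> R) -> I -> R) : Prop :=
  exists2 beta, classKL beta & forall s, nonneg s -> forall n : nat,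
    vnorm (iter n T s) <= beta (vnorm s) n%:R.

Definition strict_decay_path (G : (I -> R) -> I -> R) (sig : R -> I -> R) : Prop :=
  [/\ (exists2 rho, classKinf rho &
         forall r, 0 <= r -> vle (Gam_rho G rho (sig r)) (sig r)),
      (exists phimin phimax, [/\ classKinf phimin, classKinf phimax &
         forall r, 0 <= r -> forall i, phimin r <= sig r i <= phimax r]),
      (forall i, classKinf (fun r => sig r i)) &
      (* (iv): sig_i^{-1} written relationally: t = sig_i^{-1}(r) iff t >= 0 and sig t i = r *)
      (forall K : set R, compact K -> K `<=` [set x | 0 < x] ->
         exists l L, [/\ 0 < l, l <= L &
           forall i r1 r2 t1 t2, K r1 -> K r2 -> 0 <= t1 -> 0 <= t2 ->
             sig t1 i = r1 -> sig t2 i = r2 ->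
             l * `|r1 - r2| <= `|t1 - t2| <= L * `|r1 - r2|])].

End Defs.

(* Main.v *)
Require Import Defs.
From HB Require Import structures.
From mathcomp Require Import all_boot all_order all_algebra.
From mathcomp Require Import all_classical all_reals all_analysis.
From mathcomp Require Import ring lra zify.
Import Order.TTheory GRing.Theory Num.Theory.
Import numFieldNormedType.Exports.
Local Open Scope ring_scope.

(** Write [T] for [Gam_rho G rho], with a [rho] that may shrink from step to step.

    NJI implies MBI: if [s <= b (+) T s], erase from [s] the coordinates below a
    threshold [c >= |b|].  By uniform continuity of the [mu_i] this perturbs [G s] by
    an amount controlled by [c], which the passage from [rho' x = rho (x / 2) / 2] to
    [rho] absorbs wherever [G s] is large.  Hence either nothing is left or, by NJI,
    some coordinate lies below a larger threshold; after [#|I|] rounds all do.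

    MBI implies a path of strict decay: perturb [T] to [s |-> T s (+) eta(|s|) 1], which
    keeps MBI for small [eta] and makes all coordinates of an image comparable.  By
    Knaster-Tarski there are arbitrarily large points [a] with [T a <= a]; lower limits
    of their orbits, re-indexed from the first entrance into the unit ball, form a
    bi-infinite chain [p] with [T (p (k + 1)) <= p k <= p (k + 1)] running from 0 to
    infinity.  Once made strictly increasing, it is interpolated linearly, and every
    point [s] between [p k] and [p (k + 1)] satisfies [T s <= T (p (k + 1)) <= p k <= s]. *)

Set Implicit Arguments.
Unset Strict Implicit.

(** * The maximum norm, and uniform thresholds over finite types *)

Section Norm.
Context {R : realType} {I : finType}.
Implicit Types s t : I -> R.

Lemma vnorm_ge0 s : 0 <= vnorm s.
Proof. exact: bigmax_ge_id. Qed.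

Lemma abs_le_vnorm s i : `|s i| <= vnorm s.
Proof. exact: le_bigmax. Qed.

Lemma le_vnorm s i : s i <= vnorm s.
Proof. exact: le_trans (ler_norm _) (abs_le_vnorm s i). Qed.

Lemma vnorm_le s c : 0 <= c -> (forall i, `|s i| <= c) -> vnorm s <= c.
Proof. by move=> c0 H; apply: bigmax_le. Qed.

Lemma vnorm_le_nonneg s c :
  0 <= c -> nonneg s -> (forall i, s i <= c) -> vnorm s <= c.
Proof. by move=> c0 s0 H; apply: vnorm_le => // i; rewrite ger0_norm. Qed.

Lemma vnorm_mono s t : nonneg s -> vle s t -> vnorm s <= vnorm t.
Proof.
move=> s0 st; apply: vnorm_le_nonneg => // [|i]; first exact: vnorm_ge0.
exact: le_trans (st i) (le_vnorm t i).
Qed.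

Lemma vnorm_const_le (c : R) : 0 <= c -> vnorm (fun _ : I => c) <= c.
Proof. by move=> c0; apply: vnorm_le_nonneg => // i. Qed.

Lemma vnorm_lip s t e :
  0 <= e -> (forall i, `|s i - t i| <= e) -> `|vnorm s - vnorm t| <= e.
Proof.
move=> e0 H; suff L (u v : I -> R) : (forall i, `|u i - v i| <= e) -> vnorm u <= vnorm v + e.
  rewrite ler_distl lerBlDr !L // => i; rewrite distrC; exact: H.
move=> {}H; apply: vnorm_le => [|i]; first by rewrite addr_ge0 ?vnorm_ge0.
have -> : u i = v i + (u i - v i) by rewrite addrC subrK.
by rewrite (le_trans (ler_normD _ _)) // lerD // abs_le_vnorm.
Qed.

(** Each [P i] holds at every smaller positive [x] as well, so the minimum of the thresholds serves
    all indices; the seed 1 covers an empty [J]. *)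
Lemma fin_pos (J : finType) (P : J -> R -> Prop) :
  (forall i, exists2 d, 0 < d & forall x, 0 < x -> x <= d -> P i x) ->
  exists2 d, 0 < d & forall i x, 0 < x -> x <= d -> P i x.
Proof.
move=> /(_ _)/cid2-/all_sig2 [d d0 Hd].
exists (\big[Num.min/1]_i d i) => [|i x x0 xd]; first by rewrite lt_bigmin.
by apply: Hd => //; rewrite (le_trans xd) // bigmin_le.
Qed.

Lemma fin_eventually (J : finType) (P : J -> nat -> Prop) :
  (forall i, exists N, forall n, (N <= n)%N -> P i n) ->
  exists N, forall n, (N <= n)%N -> forall i, P i n.
Proof.
move=> /choice [N HN]; exists (\max_i N i)%N => n Hn i.
by apply: HN; rewrite (leq_trans _ Hn) // leq_bigmax.
Qed.

Lemma le_eps (x y : R) : (forall e, 0 < e -> x <= y + e) -> x <= y.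
Proof. by move=> H; apply/ler_addgt0Pr. Qed.

End Norm.

(** * Comparison functions of class K and K-infinity *)

Section Comparison.
Local Open Scope classical_set_scope.
Context {R : realType}.
Implicit Types (f : R -> R) (x y r t e M b : R).

Lemma K_le f x y : classK f -> 0 <= x -> x <= y -> f x <= f y.
Proof.
move=> [_ f_lt _] x0; rewrite le_eqVlt => /predU1P[->//|xy].
exact/ltW/f_lt.
Qed.

Lemma K_lt f x y : classK f -> 0 <= x -> x < y -> f x < f y.
Proof. by move=> [_ f_lt _]; exact: f_lt. Qed.

Lemma K_ge0 f x : classK f -> 0 <= x -> 0 <= f x.
Proof. by move=> fK x0; have [_ _ {1}<-] := fK; apply: K_le. Qed.

Lemma K_gt0 f x : classK f -> 0 < x -> 0 < f x.
Proof. by move=> fK x0; have [_ _ {1}<-] := fK; apply: K_lt. Qed.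

Lemma K_lt_inv f x y : classK f -> 0 <= y -> f x < f y -> x < y.
Proof. by move=> fK y0; apply: contraTT; rewrite -!leNgt; exact: K_le. Qed.

Lemma K_small f e : classK f -> 0 < e -> exists2 d, 0 < d &
  forall x, 0 <= x -> x <= d -> f x <= e.
Proof.
move=> fK e0; have [fc _ f0] := fK.
have [d d0 Hd] := fc 0 (lexx _) e e0; exists (d / 2) => [|x x0 xd]; first lra.
have := Hd x x0; rewrite f0 !subr0 (ger0_norm x0) (ger0_norm (K_ge0 _ x0)) //.
by move=> H; apply/ltW/H; lra.
Qed.

Lemma Kinf_large f M : classKinf f -> exists2 r, 0 < r & M <= f r.
Proof.
move=> [fK /(_ M) [r r0 Hr]]; exists (r + 1); first by lra.
by rewrite (le_trans (ltW Hr)) // K_le //; lra.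
Qed.

(** [cont0] sees only the half-line; composing with the retraction [Num.max 0] gives a function
    continuous on all of [R], ready for the intermediate value theorem. *)
Lemma cont0_ext f : cont0 f -> continuous (fun x => f (Num.max 0 x)).
Proof.
move=> fc x; apply/cvgrPdist_lt => e e0.
have x0 : 0 <= Num.max 0 x by rewrite le_max lexx.
have [d d0 Hd] := fc _ x0 e e0.
exists d => //= y xy; rewrite distrC; apply: Hd; first by rewrite le_max lexx.
apply: le_lt_trans xy; have := lexx `|x - y|; rewrite {1}ler_norml ler_norml.
by rewrite /Num.max; case: ltP => ?; case: ltP => ?; have := normr_ge0 (x - y); lra.
Qed.

Lemma cont0_IVT f b y : cont0 f -> 0 <= b -> f 0 <= y -> y <= f b ->
  exists x, [/\ 0 <= x, x <= b & f x = y].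
Proof.
move=> fc b0 y0 yb.
have Fc : {within `[0, b], continuous (fun x => f (Num.max 0 x))}.
  exact/continuous_subspaceT/cont0_ext.
have [|c] := @IVT R _ 0 b y b0 Fc.
  by rewrite maxxx (max_r b0) ge_min le_max y0 yb /= orbT.
rewrite in_itv /= => /andP [c0 cb]; rewrite (max_r c0) => fcy.
by exists c.
Qed.

(** Surjectivity comes from the intermediate value theorem; the other properties of [h] are pulled
    back through the strictly increasing [f]. *)
Lemma Kinf_inverse f : classKinf f -> exists2 h, classKinf h &
  forall x, 0 <= x -> f (h x) = x.
Proof.
move=> fKi; have [fK _] := fKi; have [fc f_lt f0] := fK.
have ex y : exists x, 0 <= y -> 0 <= x /\ f x = y.
  have [y0|y0] := lerP 0 y; last by exists 0.
  have [b b0 Hb] := Kinf_large y fKi.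
  have [|||x [x0 _ fx]] := @cont0_IVT f b y fc => //; first exact: ltW.
    by rewrite f0.
  by exists x.
have [h Hh] := choice ex.
have h0 y : 0 <= y -> 0 <= h y by case/Hh.
have fh y : 0 <= y -> f (h y) = y by case/Hh.
have h_lt x y : 0 <= x -> x < y -> h x < h y.
  move=> x0 xy; apply: (K_lt_inv fK); first by rewrite h0 //; lra.
  by rewrite !fh //; lra.
exists h => //; split=> [|M]; last first.
  exists (f (Num.max 0 M + 1)); first by rewrite K_ge0 // addr_ge0 // le_max lexx.
  have M0 : 0 <= Num.max 0 M + 1 by rewrite addr_ge0 // le_max lexx.
  have MM : M <= Num.max 0 M by rewrite le_max lexx orbT.
  have : Num.max 0 M < h (f (Num.max 0 M + 1)).
    have fM := K_ge0 fK M0; apply: (K_lt_inv fK); first exact: h0.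
    by rewrite fh //; apply: (K_lt fK); rewrite ?le_max ?lexx // ltrDl.
  lra.
split=> //; last first.
  apply/eqP; rewrite eq_le h0 // andbT leNgt; apply/negP => H.
  by have := K_gt0 fK H; rewrite fh // ltxx.
move=> x x0 e e0.
have hx0 := h0 _ x0.
have A : x < f (h x + e) by rewrite -{1}(fh _ x0); apply: (K_lt fK); lra.
have upper y : 0 <= y -> y < f (h x + e) -> h y < h x + e.
  by move=> y0 yx; apply: (K_lt_inv fK) => //; [lra | rewrite fh].
(* If [h x < e], the lower estimate is free because [h y >= 0], while [f (h x - e)] would be
   evaluated at a negative point. *)
have [hxe|hxe] := ltrP (h x) e.
  exists (f (h x + e) - x) => [|y y0 yx]; first by lra.
  rewrite ltr_norml; have := upper y y0; have := h0 _ y0.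
  by move: yx; rewrite ltr_norml; lra.
have B : f (h x - e) < x by rewrite -{2}(fh _ x0); apply: (K_lt fK); lra.
exists (Num.min (f (h x + e) - x) (x - f (h x - e))) => [|y y0].
  by rewrite lt_min; lra.
rewrite lt_min => /andP [yx yx']; rewrite ltr_norml; have := upper y y0.
have : h x - e < h y.
  apply: (K_lt_inv fK) => //; [exact: h0 | rewrite fh //].
  by move: yx'; rewrite ltr_norml; lra.
by move: yx; rewrite ltr_norml; lra.
Qed.

Lemma cont0_half f : cont0 f -> cont0 (fun x => f x / 2).
Proof.
move=> fc x x0 e e0; have [|d d0 Hd] := fc x x0 (2 * e); first lra.
exists d => // y y0 /(Hd _ y0); rewrite -mulrBl normrM (@ger0_norm _ 2^-1) //; lra.
Qed.

Lemma Kinf_half f : classKinf f -> classKinf (fun x => f x / 2).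
Proof.
move=> [[fc f_lt f0] f_inf]; split; [split|] => [|x y x0 xy||M].
- exact: cont0_half.
- by have := f_lt x y x0 xy; lra.
- by rewrite f0 mul0r.
- by have [r r0 Hr] := f_inf (2 * M); exists r => //; lra.
Qed.

Lemma Kinf_scale f : classKinf f -> classKinf (fun x => f (x / 2)).
Proof.
move=> [[fc f_lt f0] f_inf]; split; [split|] => [x x0 e e0|x y x0 xy||M].
- have [|d d0 Hd] := fc (x / 2) _ e e0; first lra.
  exists (2 * d) => [|y y0 xy]; first lra.
  by apply: Hd; [lra | rewrite -mulrBl normrM (@ger0_norm _ 2^-1) //; lra].
- by apply: f_lt; lra.
- by rewrite mul0r.
- have [r r0 Hr] := f_inf M; exists (2 * r); first lra.
  by rewrite mulrC mulKf.
Qed.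

Lemma Kinf_min f h : classKinf f -> classKinf h ->
  classKinf (fun x => Num.min (f x) (h x)).
Proof.
move=> fKi hKi; have [[fc f_lt f0] _] := fKi; have [[hc h_lt h0] _] := hKi.
split; [split|] => [x x0 e e0|x y x0 xy||M].
- have [d d0 Hd] := fc x x0 e e0; have [d' d0' Hd'] := hc x x0 e e0.
  exists (Num.min d d') => [|y y0]; first by rewrite lt_min d0.
  rewrite lt_min => /andP [/(Hd _ y0) + /(Hd' _ y0)].
  by rewrite !ltr_norml /Num.min; do 2 case: ifP => ?; lra.
- rewrite lt_min !gt_min f_lt // h_lt // orbT //.
- by rewrite f0 h0 minxx.
- have [r r0 Hr] := Kinf_large (M + 1) fKi; have [r' r0' Hr'] := Kinf_large (M + 1) hKi.
  exists (r + r'); first lra.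
  have [fK _] := fKi; have [hK _] := hKi.
  have : f r <= f (r + r') by apply: K_le => //; lra.
  have : h r' <= h (r + r') by apply: K_le => //; lra.
  by rewrite lt_min => ? ?; apply/andP; split; lra.
Qed.

Lemma Kinf_max f h : classKinf f -> classKinf h ->
  classKinf (fun x => Num.max (f x) (h x)).
Proof.
move=> fKi hKi; have [[fc f_lt f0] f_inf] := fKi; have [[hc h_lt h0] _] := hKi.
split; [split|] => [x x0 e e0|x y x0 xy||M].
- have [d d0 Hd] := fc x x0 e e0; have [d' d0' Hd'] := hc x x0 e e0.
  exists (Num.min d d') => [|y y0]; first by rewrite lt_min d0.
  rewrite lt_min => /andP [/(Hd _ y0) + /(Hd' _ y0)].
  by rewrite !ltr_norml /Num.max; do 2 case: ifP => ?; lra.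
- by rewrite gt_max !lt_max f_lt // h_lt // orbT.
- by rewrite f0 h0 maxxx.
- by have [r r0 Hr] := f_inf M; exists r => //; rewrite lt_max Hr.
Qed.

(** The fold is seeded with a member of the family, as no constant is of class K-infinity. *)
Lemma Kinf_bigmin (J : finType) (f : J -> R -> R) j0 :
  (forall j, classKinf (f j)) ->
  classKinf (fun x => \big[Num.min/f j0 x]_j f j x).
Proof.
move=> fK; elim: (index_enum J) => [|j l IH].
  by under [fun x => _]funext do rewrite big_nil; exact: fK.
by under [fun x => _]funext do rewrite big_cons; apply: Kinf_min.
Qed.

Lemma Kinf_bigmax (J : finType) (f : J -> R -> R) j0 :
  (forall j, classKinf (f j)) ->
  classKinf (fun x => \big[Num.max/f j0 x]_j f j x).
Proof.
move=> fK; elim: (index_enum J) => [|j l IH].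
  by under [fun x => _]funext do rewrite big_nil; exact: fK.
by under [fun x => _]funext do rewrite big_cons; apply: Kinf_max.
Qed.

End Comparison.

(** * Majorants of class KL and K-infinity, built from clamped weights *)

Section Clamp.
Context {R : realType}.
Implicit Types x y : R.

Definition clamp x : R := Num.max 0 (Num.min 1 x).

Lemma clamp_itv x : 0 <= clamp x <= 1.
Proof. by rewrite /clamp /Num.max /Num.min; do 2 case: ifP; lra. Qed.

Lemma clamp_ge1 x : 1 <= x -> clamp x = 1.
Proof. by rewrite /clamp /Num.max /Num.min; do 2 case: ifP; lra. Qed.

Lemma clamp_le0 x : x <= 0 -> clamp x = 0.
Proof. by rewrite /clamp /Num.max /Num.min; do 2 case: ifP; lra. Qed.

Lemma clamp_mono x y : x <= y -> clamp x <= clamp y.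
Proof. by rewrite /clamp /Num.max /Num.min; do 4 case: ifP; lra. Qed.

Lemma clamp_lip x y e : 0 <= e -> x <= y + e -> clamp x <= clamp y + e.
Proof. by rewrite /clamp /Num.max /Num.min; do 4 case: ifP; lra. Qed.

End Clamp.

Section Majorant.
Context {R : realType}.
Local Open Scope classical_set_scope.
(* [P a n y]: some trajectory of initial size [a] has size [y] at time [n]. *)
Variable P : R -> nat -> R -> Prop.
Hypothesis P_ge0 : forall a n y, P a n y -> 0 <= a /\ 0 <= y.
Hypothesis P_bounded : forall r, exists C, forall a n y, P a n y -> a <= r -> y <= C.
Hypothesis P_stable : forall e, 0 < e ->
  exists2 d, 0 < d & forall a n y, P a n y -> a <= d -> y <= e.
Hypothesis P_attractive : forall r e, 0 < e ->
  exists N, forall a n y, P a n y -> a <= r -> (N <= n)%N -> y <= e.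

(* The division by zero at [r = 0] makes the weight vanish there. *)
Let wr (r a : R) : R := clamp ((2 * r - a) / r).
Let wt (t : R) (n : nat) : R := clamp (1 + n%:R - t).
Let A (r t : R) : set R :=
  [set z | z = 0 \/ exists a n y, P a n y /\ z = y * (wr r a * wt t n)].
Let M (r t : R) : R := sup (A r t).

Let wr_itv r a : 0 <= wr r a <= 1. Proof. exact: clamp_itv. Qed.
Let wt_itv t n : 0 <= wt t n <= 1. Proof. exact: clamp_itv. Qed.

Let wr0 r a : 0 <= r -> 2 * r <= a -> wr r a = 0.
Proof.
move=> r0 ra; apply: clamp_le0; rewrite mulr_le0_ge0 ?invr_ge0 //; lra.
Qed.

Let wr1 r a : 0 < r -> a <= r -> wr r a = 1.
Proof. by move=> r0 ra; apply: clamp_ge1; rewrite ler_pdivlMr //; lra. Qed.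

Let wr_sub r a : 0 < r -> wr r a = clamp (2 - a / r).
Proof. by move=> r0; rewrite /wr; congr clamp; field; lra. Qed.

Let A_le r t e : 0 <= r -> 0 <= e ->
  (forall a n y, P a n y -> a <= 2 * r -> wt t n != 0 -> y <= e) -> ubound (A r t) e.
Proof.
move=> r0 e0 H z [->//|[a [n [y [Pany ->]]]]].
have [_ y0] := P_ge0 Pany.
have [ar|ra] := lerP a (2 * r); last by rewrite wr0 ?mul0r ?mulr0 //; lra.
have [->|w0] := eqVneq (wt t n) 0; first by rewrite !mulr0.
rewrite (le_trans _ (H _ _ _ Pany ar w0)) // ler_piMr //.
have := wr_itv r a; have := wt_itv t n => /andP [? ?] /andP [? ?].
by rewrite mulr_ile1.
Qed.

Let A0 r t : A r t 0. Proof. by left. Qed.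

Let M_le r t e : 0 <= r -> 0 <= e ->
  (forall a n y, P a n y -> a <= 2 * r -> wt t n != 0 -> y <= e) -> M r t <= e.
Proof. by move=> r0 e0 H; apply: ge_sup; [exists 0 | exact: A_le]. Qed.

Let A_sup r t : 0 <= r -> has_sup (A r t).
Proof.
move=> r0; split; first by exists 0.
have [C HC] := P_bounded (2 * r); exists (Num.max 0 C); apply: A_le => // [|a n y].
  by rewrite le_max lexx.
by move=> Pany ar _; rewrite le_max (HC _ _ _ Pany ar) orbT.
Qed.

Let M_ge r t a n y : 0 <= r -> P a n y -> y * (wr r a * wt t n) <= M r t.
Proof.
move=> r0 Pany; apply: sup_upper_bound; first exact: A_sup.
by right; exists a, n, y.
Qed.

Let M_ge0 r t : 0 <= r -> 0 <= M r t.
Proof. by move=> r0; apply: sup_upper_bound; [exact: A_sup | exact: A0]. Qed.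

Let M_cmp r t r' t' e : 0 <= r' -> 0 <= e ->
  (forall a n y, P a n y ->
     y * (wr r a * wt t n) <= y * (wr r' a * wt t' n) + e) -> M r t <= M r' t' + e.
Proof.
move=> r0 e0 H; apply: ge_sup; first by exists 0.
move=> z [->|[a [n [y [Pany ->]]]]]; first by rewrite addr_ge0 // M_ge0.
by rewrite (le_trans (H _ _ _ Pany)) // lerD2r M_ge.
Qed.

Let M_mono r t r' t' : 0 <= r -> r <= r' -> t' <= t -> M r t <= M r' t'.
Proof.
move=> r0 rr' tt'; rewrite -[M r' t']addr0; apply: M_cmp => // [|a n y Pany].
  exact: le_trans rr'.
have [a0 y0] := P_ge0 Pany.
have := wr_itv r a; have := wt_itv t n => /andP [? ?] /andP [? ?].
rewrite addr0 ler_wpM2l // ler_pM //; last by apply: clamp_mono; lra.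
(* At [r = 0] the formula [wr_sub] fails, but there the weight is 0. *)
have [->|r1] := eqVneq r 0.
  by rewrite [X in X <= _]wr0 ?mulr0 //; have /andP[] := wr_itv r' a.
rewrite !wr_sub; [|lra|lra]; apply: clamp_mono.
by rewrite lerD2l lerN2 ler_wpM2l // lef_pV2 ?posrE //; lra.
Qed.

(** For [a > 4 * r] both weights vanish. Otherwise [a / r' <= 8], which gives the constant since
    [a / r' - a / r = (a / r') / r * (r - r')]. *)
Let wr_lip r r' a : 0 < r -> r / 2 < r' -> r' <= 2 * r -> 0 <= a ->
  `|wr r' a - wr r a| <= 8 / r * `|r' - r|.
Proof.
move=> r0 rr' r'r a0; have r'0 : 0 < r' by lra.
have c0 : 0 <= 8 / r * `|r' - r| by rewrite mulr_ge0 ?divr_ge0 //; lra.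
have [ar|ra] := lerP a (4 * r); last first.
  by rewrite !wr0 ?subrr ?normr0 //; lra.
suff : `|a / r' - a / r| <= 8 / r * `|r' - r|.
  rewrite !wr_sub // ler_norml => ?; rewrite ler_distl lerBlDr.
  by apply/andP; split; apply: clamp_lip => //; lra.
have -> : a / r' - a / r = (a / r') / r * (r - r') by field; lra.
rewrite normrM (distrC r') ler_wpM2r // ger0_norm ?divr_ge0 ?(ltW r0) ?(ltW r'0) //.
by rewrite ler_wpM2r ?invr_ge0 ?(ltW r0) // ler_pdivrMr //; lra.
Qed.

Let wt_lip t t' n : wt t n <= wt t' n + `|t' - t|.
Proof. by apply: clamp_lip => //; have := ler_norm (t' - t); lra. Qed.

Let M_lip r r' t t' C : 0 < r -> r / 2 < r' -> r' <= 2 * r -> 0 <= C ->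
  (forall a n y, P a n y -> a <= 4 * r -> y <= C) ->
  `|M r' t' - M r t| <= C * (8 / r * `|r' - r| + `|t' - t|).
Proof.
move=> r0 rr' r'r C0 HC; set q := 8 / r * `|r' - r|.
have q0 : 0 <= q by rewrite mulr_ge0 ?divr_ge0 //; lra.
(* For factors in the unit interval, the error of a product is at most the sum of the errors. *)
have E u u' v v' : 0 <= u <= 1 -> 0 <= u' <= 1 -> 0 <= v <= 1 -> 0 <= v' <= 1 ->
    u <= u' + q -> v <= v' + `|t' - t| -> u * v <= u' * v' + (q + `|t' - t|).
  move=> ? ? ? ? uu vv; have n0 := normr_ge0 (t' - t).
  have [?|?] := lerP u u'; have [?|?] := lerP v v'; nra.
have e0 : 0 <= C * (q + `|t' - t|) by rewrite mulr_ge0 // addr_ge0.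
have F x x' y' y a : 0 <= y -> 0 <= a -> (a <= 4 * r -> y <= C) ->
  (x <= x' + (q + `|t' - t|)) -> (4 * r < a -> x = 0 /\ x' = 0) -> y' = y * x' ->
  y * x <= y' + C * (q + `|t' - t|).
  move=> y0 a0 yC xx' z ->; have [ar|/z [-> ->]] := lerP a (4 * r); last by lra.
  have := yC ar; have : 0 <= q + `|t' - t| by rewrite addr_ge0.
  by move=> ? ?; nra.
rewrite ler_distl lerBlDr; apply/andP; split; apply: M_cmp => //; try lra;
  move=> a n y Pany; have [a0 y0] := P_ge0 Pany;
  have := wr_lip r0 rr' r'r a0; rewrite ler_distl lerBlDr => /andP [w1 w2];
  apply: (F _ _ _ _ a) => //; try exact: HC Pany;
  try (by move=> ra; rewrite !wr0 ?mul0r //; lra).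
  apply: E => //.
by apply: E => //; rewrite distrC.
Qed.

(* A supremum of weighted sizes: the weight is 1 at [a <= r], [n = t] and vanishes
   for [a >= 2 r] or [n <= t - 1], which interpolates between the integer times. *)
Lemma KL_majorant : exists2 beta, classKL beta &
  (forall r, 0 <= r -> r <= beta r 0) /\ forall a n y, P a n y -> y <= beta a n%:R.
Proof.
(* [M] is only weakly monotone; the first summand supplies strictness in both variables and the
   bound [r <= beta r 0]. *)
pose beta r t := r / (1 + t) + M r t.
have M0 t : M 0 t = 0.
  apply/eqP; rewrite eq_le M_ge0 // andbT; apply: ge_sup; first by exists 0.
  move=> z [->//|[a [n [y [Pany ->]]]]].
  by have [a0 y0] := P_ge0 Pany; rewrite wr0 ?mul0r ?mulr0 //; lra.
have beta_cont r t : 0 <= r -> 0 <= t -> forall e, 0 < e -> exists2 d, 0 < d &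
    forall r' t', 0 <= r' -> 0 <= t' -> `|r' - r| < d -> `|t' - t| < d ->
      `|beta r' t' - beta r t| < e.
  (* The Lipschitz constant of [M] degenerates at [r = 0], where stability gives continuity
     instead. *)
  move=> r0 t0 e e0; have [r1|r1] := eqVneq r 0.
    have [|d d0 Hd] := @P_stable (e / 2); first lra.
    exists (Num.min (d / 2) (e / 2)) => [|r' t' r'0 t'0]; first by rewrite lt_min; lra.
    rewrite r1 subr0 (ger0_norm r'0) lt_min => /andP [r'd r'e] _.
    rewrite /beta M0 mul0r !addr0 subr0 ger0_norm; last first.
      by rewrite addr_ge0 ?M_ge0 // divr_ge0 //; lra.
    have : M r' t' <= e / 2.
      apply: M_le => // [|a n y Pany ar _]; first lra.
      by apply: Hd Pany _; lra.
    have : r' / (1 + t') <= r' by rewrite ler_pdivrMr; nra.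
    lra.
  have r2 : 0 < r by rewrite lt_neqAle eq_sym r1.
  have [C0 HC0] := P_bounded (4 * r).
  pose C := Num.max 0 C0 + 1.
  have Cgt0 : 0 < C by rewrite /C ltr_pwDr // le_max lexx.
  have HC a n y : P a n y -> a <= 4 * r -> y <= C.
    move=> Pany ar; rewrite /C (le_trans (HC0 _ _ _ Pany ar)) //.
    by rewrite ler_wpDr // le_max lexx orbT.
  (* A Lipschitz constant of [beta] near [(r, t)]: [1 + r] for the first summand, the rest for
     [M]. *)
  pose L := (1 + r) + C * (8 / r + 1).
  have r8 : 0 < 8 / r by rewrite divr_gt0.
  have L0 : 0 < L by rewrite /L; nra.
  exists (Num.min (r / 2) (e / (L + 1))) => [|r' t' r'0 t'0].
    by rewrite lt_min !divr_gt0 //; lra.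
  rewrite !lt_min => /andP [r'r r'e] /andP [t't t'e].
  have : `|M r' t' - M r t| <= C * (8 / r * `|r' - r| + `|t' - t|).
    by apply: M_lip HC => //; first [exact: ltW | move: r'r; rewrite ltr_norml; lra].
  have : `|r' / (1 + t') - r / (1 + t)| <= `|r' - r| + r * `|t' - t|.
    have -> : r' / (1 + t') - r / (1 + t) =
        (r' - r) / (1 + t') + r * (t - t') / ((1 + t) * (1 + t')) by field; lra.
    have inv1 (u : R) : 1 <= u -> 0 <= u^-1 <= 1.
      by move=> u1; rewrite invr_ge0 invf_le1; lra.
    rewrite (le_trans (ler_normD _ _)) // !normrM (ger0_norm r0) (distrC t).
    have /andP [i0 i1] := inv1 (1 + t') ltac:(lra).
    have /andP [j0 j1] : 0 <= ((1 + t) * (1 + t'))^-1 <= 1 by apply: inv1; nra.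
    rewrite (ger0_norm i0) (ger0_norm j0); apply: lerD; apply: ler_piMr => //.
    by rewrite mulr_ge0.
  have : L * (e / (L + 1)) < e by rewrite mulrCA gtr_pMr // ltr_pdivrMr; lra.
  set m := e / (L + 1) in r'e t'e *; set u := `|r' - r| in r'e *.
  set v := `|t' - t| in t'e *.
  move=> me h1 h2; rewrite /beta opprD addrACA (le_lt_trans (ler_normD _ _)) //.
  have : u + r * v + C * (8 / r * u + v) <= L * m; last lra.
  rewrite /L; have : r * v <= r * m by rewrite ler_pM2l //; lra.
  have : 8 / r * u <= 8 / r * m by rewrite ler_pM2l //; lra.
  set k := 8 / r in r8 *; move=> h3 h4.
  have : C * (k * u + v) <= C * (k * m + m) by rewrite ler_pM2l //; lra.
  lra.
exists beta; [split=> //|split].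
- move=> t t0; split=> [r r0 e e0|r r' r0 rr'|]; last by rewrite /beta M0 mul0r addr0.
    have [d d0 Hd] := beta_cont r t r0 t0 e e0.
    by exists d => // y y0 yr; apply: Hd => //; rewrite subrr normr0.
  rewrite /beta ltr_leD ?M_mono ?(ltW rr') // ltr_pM2r // invr_gt0; lra.
- move=> r r0; have r0' := ltW r0; split=> [t t0 e e0|t t' t0 tt'|e e0].
  + have [d d0 Hd] := beta_cont r t r0' t0 e e0.
    by exists d => // y y0 yr; apply: Hd => //; rewrite subrr normr0.
  + rewrite /beta ltr_leD ?M_mono ?(ltW tt') // ltr_pM2l // ltf_pV2 ?posrE; lra.
  + have [|N HN] := P_attractive (2 * r) (e := e / 2); first lra.
    (* The summand [N] annihilates the weights of all times before [N]; the other one makes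
       [r / (1 + t)] smaller than [e / 2]. *)
    exists (N%:R + 2 * r / e) => t tN.
    have q0 : 0 < 2 * r / e by rewrite divr_gt0 //; lra.
    have N0 : 0 <= N%:R :> R by [].
    have : M r t <= e / 2.
      apply: M_le => // [|a n y Pany ar wtn]; first lra.
      apply: HN Pany ar _; rewrite leqNgt; apply/negP => nN.
      move/eqP: wtn; apply; apply: clamp_le0.
      by have : n.+1%:R <= N%:R :> R; [rewrite ler_nat | rewrite -natr1; lra].
    have : r / (1 + t) < e / 2; last by rewrite /beta; lra.
    rewrite ltr_pdivrMr; last lra.
    have : 2 * r / e * e = 2 * r by rewrite divfK //; lra.
    by nra.
- by move=> r r0; rewrite /beta addr0 divr1 lerDl M_ge0.
- move=> a n y Pany; have [a0 y0] := P_ge0 Pany.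
  (* The weight is 0 at [r = a = 0], so this case rests on stability, which forces [y = 0]. *)
  have [a1|a1] := eqVneq a 0.
    suff -> : y = 0 by rewrite a1 /beta mul0r add0r M0.
    apply/eqP; rewrite eq_le y0 andbT; apply: le_eps => e e0.
    have [d d0 Hd] := P_stable e0; rewrite add0r.
    by apply: Hd Pany _; lra.
  have := M_ge n%:R a0 Pany.
  rewrite wr1 ?lt_neqAle 1?eq_sym ?a1 // /wt addrK clamp_ge1 // !mulr1 /beta.
  have : 0 <= a / (1 + n%:R) by rewrite divr_ge0.
  lra.
Qed.

End Majorant.

Section KMajorant.
Context {R : realType}.

(** All data are placed at time 0 of [KL_majorant]: attractivity is then vacuous from time 1 on, and
    unboundedness follows from [r <= beta r 0]. *)
Lemma Kinf_majorant (P : R -> R -> Prop) :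
  (forall a y, P a y -> 0 <= a /\ 0 <= y) ->
  (forall r, exists C, forall a y, P a y -> a <= r -> y <= C) ->
  (forall e, 0 < e -> exists2 d, 0 < d & forall a y, P a y -> a <= d -> y <= e) ->
  exists2 phi, classKinf phi & forall a y, P a y -> y <= phi a.
Proof.
move=> P0 Pb Ps.
have [||||beta [_ bK _] [bge HP]] := @KL_majorant R (fun a n y => n = 0%N /\ P a y).
- by move=> a n y [_ /P0].
- by move=> r; have [C HC] := Pb r; exists C => a n y [_ Pay]; apply: HC.
- by move=> e e0; have [d d0 Hd] := Ps e e0; exists d => // a n y [_ Pay]; apply: Hd.
- by move=> r e e0; exists 1%N => a n y [->].
exists (fun r => beta r 0) => [|a y Pay]; last by apply: (HP a 0%N).
split; first exact: bK.
move=> M; exists (Num.max 0 M + 1); first by rewrite addr_ge0 // le_max lexx.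
have M0 : 0 <= Num.max 0 M by rewrite le_max lexx.
have MM : M <= Num.max 0 M by rewrite le_max lexx orbT.
by have := bge (Num.max 0 M + 1); lra.
Qed.

End KMajorant.

(** * Monotone operators, and the implications that lead back to NJI *)

Section MonotoneOperators.
Context {R : realType} {I : finType}.
Implicit Types (s t : I -> R) (T G : (I -> R) -> I -> R).

Definition op_ge0 T := forall s, nonneg s -> nonneg (T s).
Definition op_mono T := forall s t, nonneg s -> vle s t -> vle (T s) (T t).
Definition op_cont T := forall s, nonneg s -> forall e, 0 < e ->
  exists2 d, 0 < d & forall t, nonneg t -> (forall i, `|t i - s i| <= d) ->
    forall i, `|T t i - T s i| <= e.

Lemma nonneg_le s t : nonneg s -> vle s t -> nonneg t.
Proof. by move=> s0 st i; exact: le_trans (s0 i) (st i). Qed.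

Lemma Gam_rho_ge0 G rho : classK rho -> op_ge0 G -> op_ge0 (Gam_rho G rho).
Proof. by move=> rK G0 s s0 i; rewrite addr_ge0 ?K_ge0 ?G0. Qed.

Lemma Gam_rho_mono G rho : classK rho -> op_ge0 G -> op_mono G ->
  op_mono (Gam_rho G rho).
Proof.
move=> rK G0 Gm s t s0 st i; have := Gm s t s0 st i => Gst.
by rewrite lerD // K_le // G0.
Qed.

Lemma Gam_rho_cont G rho : classK rho -> op_ge0 G -> op_cont G ->
  op_cont (Gam_rho G rho).
Proof.
move=> rK G0 Gc s s0 e e0; have [rc _ _] := rK.
have [|d d0 Hd] := @fin_pos R I (fun i x => forall y, 0 <= y -> `|y - G s i| <= x ->
    `|rho y - rho (G s i)| <= e / 2).
  move=> i; have [|d d0 Hd] := rc (G s i) (G0 s s0 i) (e / 2); first lra.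
  exists (d / 2) => [|x x0 xd y y0 yx]; first lra.
  by apply/ltW/Hd => //; lra.
have [|d' d'0 Hd'] := Gc s s0 (Num.min d (e / 2)).
  by rewrite lt_min d0 divr_gt0.
exists d' => // t t0 ts i; have := Hd' t t0 ts i.
rewrite le_min => /andP [Gd Ge].
rewrite /Gam_rho opprD addrACA (le_trans (ler_normD _ _)) //.
have := Hd i d d0 (lexx _) (G t i) (G0 t t0 i) Gd; lra.
Qed.

(** For [b = 0], a vector dominated by its image has norm at most [phi 0 = 0]. *)
Lemma MBI_NJI T : oplus_MBI T -> NJI T.
Proof.
move=> [phi [phiK _] HT] s [s0 [i si]] sT.
have := HT s (fun=> 0) s0 (fun=> lexx _).
have [_ _ phi0] := phiK.
have -> : vnorm (fun _ : I => 0 : R) = 0.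
  by apply/eqP; rewrite eq_le vnorm_ge0 vnorm_const_le.
rewrite phi0 => H; have /H : vle s (vmax (fun=> 0) (T s)).
  by move=> j; rewrite /vmax le_max sT orbT.
have si0 : 0 < s i by rewrite lt_neqAle eq_sym si s0.
by rewrite leNgt (lt_le_trans si0 (le_vnorm s i)).
Qed.

Lemma uNJI_NJI Ii T : uNJI Ii T -> NJI T.
Proof.
move=> HT s [s0 [i si]] sT.
have si0 : 0 < s i by rewrite lt_neqAle eq_sym si s0.
have [||n [d _ Hd]] := HT (vnorm s) (s i) => //.
  exact: lt_le_trans si0 (le_vnorm s i).
have [j [_ _]] := Hd s i s0 (lexx _) (lexx _).
by rewrite ltNge sT.
Qed.

(** If [s <= T s], monotonicity keeps the whole orbit above [s], so it cannot tend to 0. *)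
Lemma UGAS_NJI T : op_ge0 T -> op_mono T -> UGAS T -> NJI T.
Proof.
move=> T0 Tm [beta [_ _ bt] HT] s [s0 [i si]] sT.
have si0 : 0 < s i by rewrite lt_neqAle eq_sym si s0.
have iter_ge n : vle s (iter n T s).
  elim: n => [|n IH] j //=; apply: le_trans (sT j) _.
  exact: Tm.
have sv : 0 < vnorm s := lt_le_trans si0 (le_vnorm s i).
have [_ _ /(_ _ si0) [t Ht]] := bt _ sv.
pose n := Num.bound `|t|.
have tn : t <= n%:R by rewrite (le_trans (ler_norm _)) // ltW // archi_boundP.
have := Ht _ tn; have := HT s s0 n; have := iter_ge n i.
by have := le_vnorm (iter n T s) i; lra.
Qed.

(* [Gam_rho G (rho / 2)] already fails to dominate [s]: take the least [r] with
   [s <= sig r] and compare at a coordinate where equality holds. *)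
Lemma path_NJI G sig : op_ge0 G -> op_mono G -> strict_decay_path G sig ->
  exists2 rho, classKinf rho & NJI (Gam_rho G rho).
Proof.
move=> G0 Gm [[rho rK Hrho] _ sK _].
exists (fun x => rho x / 2); first exact: Kinf_half.
move=> s [s0 [i si]] sT.
have si0 : 0 < s i by rewrite lt_neqAle eq_sym si s0.
have sig_cont j : cont0 (fun r => sig r j) by have [[]] := sK j.
have sig0 j : sig 0 j = 0 by have [[]] := sK j.
have ex j : exists r, 0 <= r /\ sig r j = s j.
  have [b b0 Hb] := Kinf_large (s j) (sK j).
  have [|||x [x0 _ xs]] := @cont0_IVT R (fun r => sig r j) b (s j) (sig_cont j) => //.
  - exact: ltW.
  - by rewrite sig0; exact: s0.
  by exists x.
have [r Hr] := choice ex.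
(* The least parameter whose path point dominates [s] is the largest of the [r j]; equality holds at
   the maximizing [k]. *)
have [k _ Hk] := @arg_maxP _ _ I i xpredT r isT.
have rk0 : 0 <= r k by case: (Hr k).
have s_le j : s j <= sig (r k) j.
  have [rj0 <-] := Hr j; apply: (@K_le _ (fun r => sig r j)) => //; last exact: Hk.
  by have [] := sK j.
have sk : s k = sig (r k) k by case: (Hr k).
have sig_ge0 : nonneg (sig (r k)) by exact: nonneg_le s_le.
have rk : 0 < r k.
  rewrite lt_neqAle rk0 andbT eq_sym; apply: contraTneq si0 => rk_eq0.
  by rewrite -leNgt; have := s_le i; rewrite rk_eq0 sig0.
have sk0 : 0 < s k.
  by rewrite sk -(sig0 k); apply: (@K_lt _ (fun r => sig r k)) => //; have [] := sK k.
have := sT k; have := Hrho _ rk0 k; rewrite -sk /Gam_rho => h1 h2.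
have Gs : G s k <= G (sig (r k)) k by apply: Gm.
have [rK' _] := rK; have rs := @K_le _ rho _ _ rK' (G0 s s0 k) Gs.
have Gp := G0 _ sig_ge0 k.
(* If [G (sig (r k)) k] vanishes, then [s k <= 0]; otherwise half of a positive [rho] value is
   strictly less than the whole. *)
have [Ge|Ge] := eqVneq (G (sig (r k)) k) 0.
  have : rho (G s k) = 0.
    apply/eqP; rewrite eq_le (K_ge0 rK' (G0 s s0 k)) andbT (le_trans rs) // Ge.
    by have [_ _ ->] := rK'.
  lra.
by have : 0 < rho (G (sig (r k)) k); [apply: K_gt0; rewrite // lt_neqAle eq_sym Ge | lra].
Qed.

End MonotoneOperators.

(** * From NJI to MBI by erasing small coordinates *)

Section Truncation.
Context {R : realType} {I : finType}.
Implicit Types (s t : I -> R).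

Definition trunc (c : R) s : I -> R := fun j => if c < s j then s j else 0.

Lemma trunc_ge0 c s : nonneg s -> nonneg (trunc c s).
Proof. by move=> s0 j; rewrite /trunc; case: ifP. Qed.

Variables (G : (I -> R) -> I -> R) (rho : R -> R).
Hypothesis G_ge0 : op_ge0 G.
Hypothesis G_trunc_bounded : forall c, 0 <= c -> exists2 E, 0 <= E &
  forall s i, nonneg s -> `|G s i - G (trunc c s) i| <= E.
Hypothesis G_trunc_small : forall e, 0 < e -> exists2 c0, 0 < c0 &
  forall c s i, 0 < c -> c <= c0 -> nonneg s -> `|G s i - G (trunc c s) i| <= e.
Hypothesis rhoK : classKinf rho.
Hypothesis G_NJI : NJI (Gam_rho G rho).

Let rho' x := rho (x / 2) / 2.

(* A coordinate that is driven by [Gam_rho G rho'] and exceeds [c'] stays driven, now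
   by [Gam_rho G rho], after the coordinates not exceeding [c] have been erased. *)
Let step c c' := c <= c' /\ forall s i, nonneg s -> s i <= Gam_rho G rho' s i ->
  c' < s i -> s i <= Gam_rho G rho (trunc c s) i.

(** Above the level [M] of [G s i] an error [E] is absorbed: [E <= M / 2] keeps the truncated value
    above [G s i / 2], and the half of [rho (G s i / 2)] that [rho'] leaves over covers [E]. The
    condition [M + rho' M <= c'] ensures [G s i > M]. *)
Let step_intro c c' E M : 0 <= E -> 2 * E <= M -> 2 * E <= rho (M / 2) ->
  (forall s i, nonneg s -> `|G s i - G (trunc c s) i| <= E) ->
  c <= c' -> M + rho' M <= c' -> step c c'.
Proof.
have [rK _] := rhoK; move=> E0 EM EM' GE cc' Mc'; split=> // s i s0 sT sc.
have := GE s i s0; rewrite ler_norml => /andP [_ GE1].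
have Gp := G_ge0 s0 i; have Gq := G_ge0 (trunc_ge0 c s0) i.
rewrite /Gam_rho in sT *; rewrite /rho' in Mc' sT.
have MG : M < G s i.
  rewrite ltNge; apply/negP => GM.
  by have : rho (G s i / 2) <= rho (M / 2); [apply: K_le => //; lra | lra].
have r1 : rho (M / 2) <= rho (G s i / 2) by apply: K_le => //; lra.
have r2 : rho (G s i / 2) <= rho (G (trunc c s) i) by apply: K_le => //; lra.
lra.
Qed.

Let step_up c : 0 <= c -> exists c', step c c'.
Proof.
move=> c0; have [E E0 HE] := G_trunc_bounded c0.
have [rK _] := rhoK; have [r r0 Hr] := Kinf_large (2 * E) rhoK.
have [M ME] : exists M, M = 2 * r + 2 * E by eexists.
have rp : 0 <= rho' M by rewrite /rho' divr_ge0 // K_ge0 //; lra.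
exists (c + (M + rho' M)); apply: (step_intro E0 _ _ HE (M := M)); try lra.
by rewrite (le_trans Hr) // K_le //; lra.
Qed.

Let step_down e : 0 < e -> exists2 d, 0 < d & step d e.
Proof.
move=> e0; have [rK _] := rhoK.
have [|m m0 Hm] := @K_small R rho (e / 2) rK; first lra.
(* Then [M <= e / 2] and [rho' M <= e / 4], so [M + rho' M] stays below the target [e]. *)
pose M := Num.min m (e / 2).
have M0 : 0 < M by rewrite lt_min m0 divr_gt0.
have Mm : M <= m by rewrite ge_min lexx.
have Me : M <= e / 2 by rewrite ge_min lexx orbT.
have rM : 0 < rho (M / 2) by apply: K_gt0 => //; lra.
pose E := Num.min (rho (M / 2) / 2) (M / 2).
have E0 : 0 < E by rewrite lt_min !divr_gt0.
have [c0 c00 Hc] := G_trunc_small E0.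
have d0 : 0 < Num.min c0 e by rewrite lt_min c00.
have E1 : E <= rho (M / 2) / 2 by rewrite ge_min lexx.
have E2 : E <= M / 2 by rewrite ge_min lexx orbT.
exists (Num.min c0 e) => //; apply: (@step_intro _ _ E M); try lra.
- by move=> s i s0; apply: Hc; rewrite // ge_min lexx.
- by rewrite ge_min lexx orbT.
- have : rho (M / 2) <= e / 2 by apply: Hm; lra.
  by rewrite /rho'; lra.
Qed.

Let J (c : R) s : {set I} := finset (fun i => c < s i).

Let Fixpoint chain (n : nat) (c c' : R) : Prop :=
  if n is n'.+1 then exists2 c1, step c c1 & chain n' c1 c' else c = c'.

Let chain_le n c c' : chain n c c' -> c <= c'.
Proof.
elim: n c => [|n IH] c /=; first by move=> ->.
by move=> [c1 [cc1 _] /IH]; exact: le_trans.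
Qed.

Let chain_up n c : 0 <= c -> exists c', chain n c c'.
Proof.
elim: n c => [|n IH] c c0; first by exists c.
have [c1 st] := step_up c0; have [cc1 _] := st.
by have [c' H] := IH c1 (le_trans c0 cc1); exists c', c1.
Qed.

Let chain_rcons n c c1 c' : chain n c c1 -> step c1 c' -> chain n.+1 c c'.
Proof.
elim: n c => [|n IH] c /=; first by move=> -> st; exists c'.
by move=> [c2 st2 H] st; exists c2 => //; exact: IH.
Qed.

Let chain_down n e : 0 < e -> exists2 d, 0 < d & chain n d e.
Proof.
elim: n e => [|n IH] e e0; first by exists e.
have [d d0 st] := step_down e0; have [d' d'0 H] := IH d d0.
by exists d' => //; exact: chain_rcons st.
Qed.

(* Along a step either nothing exceeds the first threshold, or, by the NJI condition
   for the truncated vector, some coordinate falls below the second one. *)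
Let chain_bound n c c' s : nonneg s -> 0 <= c -> chain n c c' ->
  (#|J c s| <= n)%N ->
  (forall i, c < s i -> s i <= Gam_rho G rho' s i) -> forall i, s i <= c'.
Proof.
move=> s0; elim: n c => [|n IH] c c0 ch.
  rewrite leqn0 cards_eq0 => /eqP J0 _ i; rewrite leNgt -ch.
  by have := finset.in_set0 i; rewrite -J0 inE => ->.
case: ch => [c1 [cc1 st] ch] Jn sT; apply: (IH c1) => //; first exact: le_trans cc1.
  have Jsub : J c1 s \subset J c s.
    by apply/fintype.subsetP => i; rewrite !inE; exact: le_lt_trans.
  have [E|NE] := eqVneq (J c1 s) (J c s); last first.
    by rewrite -ltnS (leq_trans _ Jn) // proper_card // finset.properEneq NE.
  suff -> : J c1 s = finset.set0 by rewrite cards0.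
  rewrite E; apply/finset.setP => i; rewrite !inE; apply/negP => ci.
  have [] := @G_NJI (trunc c s).
    split; first exact: trunc_ge0.
    by exists i; rewrite /trunc ci; apply/eqP; lra.
  move=> j; have tr0 := trunc_ge0 c s0.
  rewrite [X in X <= _]/trunc; case: ifPn => cj.
    apply: st => //; first exact: sT.
    by have : j \in J c1 s; [rewrite E inE | rewrite inE].
  by have [rK _] := rhoK; exact: Gam_rho_ge0 rK G_ge0 _ tr0 j.
by move=> i ci; apply: sT; exact: le_lt_trans ci.
Qed.

(** [Kinf_majorant] applies to the pairs of norms of [b] and [s]: chains starting at a given radius
    bound [s], and chains ending at a given [e] make it small. *)
Lemma NJI_MBI : oplus_MBI (Gam_rho G rho').
Proof.
pose P a y := exists s b, [/\ nonneg s, nonneg b,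
  vle s (vmax b (Gam_rho G rho' s)), a = vnorm b & y = vnorm s].
have key c c' a y : 0 <= c -> chain #|I| c c' -> P a y -> a <= c -> y <= c'.
  move=> c0 ch [s [b [s0 b0 sb -> ->]]] bc.
  apply: vnorm_le_nonneg => //; first exact: le_trans (chain_le ch).
  apply: chain_bound ch _ _ => //; first by rewrite max_card.
  move=> i ci; have := sb i; rewrite /vmax le_max => /orP [sbi|//].
  by have := le_lt_trans (le_trans (le_trans sbi (le_vnorm b i)) bc) ci; rewrite ltxx.
have [|||phi phiK Hphi] := @Kinf_majorant R P.
- by move=> a y [s [b [_ _ _ -> ->]]]; rewrite !vnorm_ge0.
- move=> r; have [|C HC] := @chain_up #|I| (Num.max 0 r); first by rewrite le_max lexx.
  exists C => a y Pay ar; apply: key HC Pay _; first by rewrite le_max lexx.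
  by rewrite le_max ar orbT.
- move=> e e0; have [d d0 Hd] := chain_down #|I| e0; exists d => // a y Pay ad.
  by apply: key Hd Pay ad; exact: ltW.
by exists phi => // s b s0 b0 sb; apply: Hphi; exists s, b.
Qed.

End Truncation.

(** * Regularity of the gain operator *)

Section GainOperator.
Context {R : realType} {I : finType}.
Implicit Types (s t : I -> R).

(** The orthant is convex: the segment from [s] to [t] is cut into [n] pieces of length at most [d],
    each contributing at most 1. *)
Lemma unif_cont_large (m : (I -> R) -> \bar R) : unif_cont m ->
  exists2 d, 0 < d & forall n s t, nonneg s -> nonneg t ->
    (forall j, `|s j - t j| <= n%:R * d) -> `|fine (m s) - fine (m t)| <= n%:R.
Proof.
move=> mu; have [d d0 Hd] := mu 1 ltr01; exists d => //.
elim=> [|n IH] s t s0 t0 st.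
  suff -> : s = t by rewrite subrr normr0.
  by apply/funext => j; apply/eqP; rewrite -subr_eq0 -normr_le0 (le_trans (st j)) // mul0r.
pose l : R := n.+1%:R^-1.
have l0 : 0 < l by rewrite invr_gt0.
have l1 : l <= 1 by rewrite invf_le1 // ler1n.
have ln : l * n.+1%:R = 1 by rewrite mulVf.
have nE : n.+1%:R = n%:R + 1 :> R by rewrite natr1.
have n0 : 0 <= n%:R :> R by [].
pose u j := s j + l * (t j - s j).
have u0 : nonneg u.
  by move=> j; rewrite /u; have := s0 j; have := t0 j; nra.
rewrite -(subrKA (fine (m u))) nE addrC (le_trans (ler_normD _ _)) // lerD //.
  apply: IH => // j; rewrite /u.
  have -> : s j + l * (t j - s j) - t j = (1 - l) * (s j - t j) by ring.
  have -> : n%:R * d = (1 - l) * (n.+1%:R * d).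
    by rewrite mulrA mulrBl ln mul1r nE addrK.
  by rewrite normrM ger0_norm ?subr_ge0 // ler_wpM2l // subr_ge0.
apply: Hd => //; apply: vnorm_le => [|j]; first exact: ltW.
rewrite /vsub /u; have -> : s j - (s j + l * (t j - s j)) = l * (s j - t j) by ring.
rewrite normrM ger0_norm ?(ltW l0) // (le_trans (ler_wpM2l (ltW l0) (st j))) //.
by rewrite mulrA ln mul1r.
Qed.

Variables (Ii : I -> {set I}) (g : I -> I -> R -> R) (mu : I -> (I -> R) -> \bar R).
Hypothesis gain : is_gain_operator Ii g mu.
Hypothesis mu_uc : forall i, unif_cont (mu i).

Let arg s i j : R := if j \in Ii i then g i j (s j) else 0.

Let arg_ge0 s i : nonneg s -> nonneg (arg s i).
Proof.
move=> s0 j; rewrite /arg; case: ifP => // ji; have [_ gK _ _ _] := gain.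
by have [gK' _] := gK i j ji; exact: K_ge0.
Qed.

(** As [I] is finite, [M3] may be used with the full index set. *)
Let mu_fin i s : nonneg s -> mu i s \is a fin_num.
Proof.
move=> s0; have [_ _ _ _ [M3 _]] := gain.
by have [+ _] := M3 i [set: I]%SET; apply; split=> // j; rewrite inE.
Qed.

Lemma Gam_ge0 : op_ge0 (Gam Ii g mu).
Proof.
move=> s s0 i; have [_ _ _ [[xi [xK _] M1] _] _] := gain.
have [_ H] := M1 i; apply/fine_ge0/(le_trans _ (H _ (arg_ge0 i s0))).
by rewrite lee_fin K_ge0 // vnorm_ge0.
Qed.

Lemma Gam_mono : op_mono (Gam Ii g mu).
Proof.
move=> s t s0 st i; have t0 := nonneg_le s0 st.
have [_ gK _ [_ M2] _] := gain.
apply: fine_le; [exact: mu_fin (arg_ge0 i s0)|exact: mu_fin (arg_ge0 i t0)|].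
apply: M2; first exact: (arg_ge0 i s0).
by move=> j; case: ifP => // ji; have [gK' _] := gK i j ji; exact: K_le.
Qed.

Lemma Gam_cont : op_cont (Gam Ii g mu).
Proof.
move=> s s0 e e0; have [_ gK _ _ _] := gain.
have /(_ _)/cid2-/all_sig2 [d d0 Hd] := fun i => mu_uc i e0.
have [|x x0 Hx] := @fin_pos R (I * I)%type (fun p x => forall y, 0 <= y ->
    `|y - s p.2| <= x -> p.2 \in Ii p.1 ->
    `|g p.1 p.2 y - g p.1 p.2 (s p.2)| <= d p.1).
  move=> [i j] /=; have [ji|ji] := boolP (j \in Ii i); last by exists 1.
  have [[gc _ _] _] := gK i j ji.
  have [x x0 Hx] := gc _ (s0 j) _ (d0 i); exists (x / 2) => [|z z0 zx y y0 yz _].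
    by rewrite divr_gt0.
  by apply/ltW/Hx => //; lra.
exists x => // t t0 ts i; apply: Hd; [exact: arg_ge0|exact: arg_ge0|].
apply: vnorm_le => [|j]; first exact: ltW.
rewrite /vsub /arg; case: ifP => ji; last by rewrite subrr normr0 ltW.
exact: (Hx (i, j) x x0).
Qed.

Let arg_trunc s c i j : 0 <= c -> nonneg s ->
  `|arg s i j - arg (trunc c s) i j| <= if j \in Ii i then g i j c else 0.
Proof.
move=> c0 s0; have [_ gK _ _ _] := gain.
rewrite /arg /trunc; case: ifP => [ji|]; last by rewrite subrr normr0.
have [gK' _] := gK i j ji; case: ltP => sc.
  by rewrite subrr normr0 K_ge0.
by have [_ _ ->] := gK'; rewrite subr0 ger0_norm ?K_ge0 // K_le.
Qed.

(** Truncation moves each argument of [mu i] by at most [g i j c], whatever the size of [s]; uniform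
    continuity, in the form [unif_cont_large], turns this into a bound independent of [s]. *)
Lemma Gam_trunc_bounded c : 0 <= c -> exists2 E, 0 <= E & forall s i, nonneg s ->
  `|Gam Ii g mu s i - Gam Ii g mu (trunc c s) i| <= E.
Proof.
move=> c0; have /(_ _)/cid2-/all_sig2 [d d0 Hd] := fun i => unif_cont_large (mu_uc i).
have [n Hn] : exists n : nat, forall i j, j \in Ii i -> g i j c <= n%:R * d i.
  have [|n Hn] := @fin_eventually (I * I)%type (fun p n =>
      p.2 \in Ii p.1 -> g p.1 p.2 c <= n%:R * d p.1).
    move=> [i j] /=; exists (Num.bound `|g i j c / d i|) => n Hn ji.
    rewrite -ler_pdivrMr // (le_trans (ler_norm _)) // ltW //.
    by rewrite (lt_le_trans (archi_boundP _)) // ler_nat.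
  by exists n => i j ji; apply: (Hn n (leqnn n) (i, j)).
exists n%:R => // s i s0; apply: Hd; [exact: arg_ge0|exact/arg_ge0/trunc_ge0|move=> j].
rewrite (le_trans (arg_trunc i j c0 s0)) //; case: ifP => ji; first exact: Hn.
by rewrite mulr_ge0 // ltW.
Qed.

Lemma Gam_trunc_small e : 0 < e -> exists2 c0, 0 < c0 & forall c s i,
  0 < c -> c <= c0 -> nonneg s -> `|Gam Ii g mu s i - Gam Ii g mu (trunc c s) i| <= e.
Proof.
move=> e0; have [_ gK _ _ _] := gain.
have /(_ _)/cid2-/all_sig2 [d d0 Hd] := fun i => mu_uc i e0.
have [|x x0 Hx] := @fin_pos R (I * I)%type (fun p x =>
    p.2 \in Ii p.1 -> g p.1 p.2 x <= d p.1).
  move=> [i j] /=; have [ji|ji] := boolP (j \in Ii i); last by exists 1.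
  have [gK' _] := gK i j ji; have [x x0 Hx] := K_small gK' (d0 i).
  by exists x => // y y0 yx _; apply: Hx => //; exact: ltW.
exists x => // c s i c0 cx s0.
apply: Hd; [exact: arg_ge0|exact/arg_ge0/trunc_ge0|].
apply: vnorm_le => [|j]; first exact: ltW.
rewrite (le_trans (arg_trunc i j (ltW c0) s0)) //; case: ifP => ji; last exact: ltW.
exact: (Hx (i, j)).
Qed.

Lemma Gam_local s t i : (forall j, j \in Ii i -> s j = t j) ->
  Gam Ii g mu s i = Gam Ii g mu t i.
Proof.
move=> st; rewrite /Gam; congr (fine (mu i _)); apply/funext => j.
by case: ifP => // /st ->.
Qed.

End GainOperator.

(** * Consequences of MBI: uniform NJI, decay points and UGAS *)

Section MBI.
Context {R : realType} {I : finType}.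
Implicit Types (s t b : I -> R).
Local Open Scope classical_set_scope.

Lemma Nin_mono (Ii : I -> {set I}) i n m j : (n <= m)%N -> Nin Ii i n j -> Nin Ii i m j.
Proof.
by elim: m => [|m IH]; [rewrite leqn0 => /eqP ->
  | rewrite leq_eqVlt => /predU1P [->//|nm] /(IH nm); left].
Qed.

(** The neighbourhoods grow with the path length, and there are only finitely many pairs of
    vertices. *)
Lemma Nin_stable (Ii : I -> {set I}) : exists N, forall i j m,
  Nin Ii i m j -> Nin Ii i N j.
Proof.
have [|N HN] := @fin_eventually (I * I)%type (fun p n =>
    forall m, Nin Ii p.1 m p.2 -> Nin Ii p.1 n p.2).
  move=> [i j] /=; have [[m Hm]|H] := pselect (exists m, Nin Ii i m j).
    by exists m => n mn _ _; exact: Nin_mono Hm.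
  by exists 0%N => n _ m Hm; case: H; exists m.
by exists N => i j m; exact: (HN N (leqnn N) (i, j)).
Qed.

(** The restriction [t] of [s] to the ancestors of [i] has the same images there as [s]. If no
    ancestor is suitable, [t] is driven by the constant [d] and MBI yields [s i <= e / 2]. *)
Lemma MBI_uNJI (Ii : I -> {set I}) (T : (I -> R) -> I -> R) :
  op_ge0 T ->
  (forall s t i, (forall j, j \in Ii i -> s j = t j) -> T s i = T t i) ->
  oplus_MBI T -> uNJI Ii T.
Proof.
move=> T0 Tloc [phi [phiK _] HT] r e r0 e0.
have [N HN] := Nin_stable Ii; exists N.
have [|d d0 Hd] := @K_small R phi (e / 2) phiK; first lra.
exists d => // s i s0 es _; apply: contrapT => none.
pose t j := if `[< Nin Ii i N j >] then s j else 0.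
have t0 : nonneg t by move=> j; rewrite /t; case: ifP.
have ti : t i = s i.
  by rewrite /t; case: asboolP => // -[]; apply: (Nin_mono (n := 0)).
have b0 : nonneg (fun _ : I => d) by move=> j; exact: ltW.
have /(HT _ _ t0 b0) : vle t (vmax (fun=> d) (T t)).
  move=> j; rewrite /vmax le_max {1 2}/t; case: asboolP => [Nj|_]; last by rewrite ltW.
  have [sd|ds] := lerP (s j) d; first by [].
  apply/orP; right; rewrite (_ : T t j = T s j); last first.
    apply: Tloc => k kj; rewrite /t; case: asboolP => // -[].
    (* A path of length [N.+1] may be replaced by one of length at most [N], so the ancestors are
       closed under in-neighbours. *)
    by apply: (HN _ _ N.+1); right; exists j.
  rewrite leNgt; apply/negP => Tj; apply: none; exists j; split=> //.
  exact: ltW.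
move=> H; have := le_vnorm t i; rewrite ti.
have : phi (vnorm (fun _ : I => d)) <= e / 2.
  by apply: Hd; rewrite ?vnorm_ge0 // vnorm_const_le // ltW.
lra.
Qed.

Lemma iter_ge0 (T : (I -> R) -> I -> R) n s : op_ge0 T -> nonneg s -> nonneg (iter n T s).
Proof. by move=> T0 s0; elim: n => //= n; exact: T0. Qed.

Lemma iter_mono (T : (I -> R) -> I -> R) n s t : op_ge0 T -> op_mono T ->
  nonneg s -> vle s t -> vle (iter n T s) (iter n T t).
Proof.
move=> T0 Tm s0 st; elim: n => //= n IH; apply: Tm => //; exact: iter_ge0.
Qed.

Variables (T : (I -> R) -> I -> R) (phi : R -> R).
Hypothesis T0 : op_ge0 T.
Hypothesis Tm : op_mono T.
Hypothesis phiK : classKinf phi.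
Hypothesis T_MBI : forall s b, nonneg s -> nonneg b ->
  vle s (vmax b (T s)) -> vnorm s <= phi (vnorm b).

(* Knaster-Tarski for the monotone operator [b (+) T(.)], whose post-fixed points are
   bounded by the MBI property. *)
Lemma decay_point b : nonneg b ->
  exists a, [/\ vle b a, vle (T a) a & vnorm a <= phi (vnorm b)].
Proof.
move=> b0; pose D s := nonneg s /\ vle s (vmax b (T s)).
pose A i : set R := [set x | exists2 s, D s & x = s i].
have Db : D b by split=> // i; rewrite /vmax le_max lexx.
have A_sup i : has_sup (A i).
  split; first by exists (b i), b.
  exists (phi (vnorm b)) => x [s [s0 sb] ->].
  by rewrite (le_trans (le_vnorm s i)) // T_MBI.
pose a i := sup (A i).
have D_le s : D s -> vle s a.
  by move=> Ds i; apply: sup_upper_bound => //; exists s.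
have ba := D_le b Db; have a0 := nonneg_le b0 ba.
have aF : vle a (vmax b (T a)).
  move=> i; apply: ge_sup; first by exists (b i), b.
  move=> x [s Ds ->]; have [s0 sb] := Ds; apply: le_trans (sb i) _.
  by rewrite /vmax ge_max !le_max lexx /= (Tm s0 (D_le s Ds)) orbT.
exists a; split=> //; last exact: T_MBI.
have F0 : nonneg (vmax b (T a)) by exact: nonneg_le aF.
have /D_le Fa : D (vmax b (T a)).
  split=> // i; rewrite {1}/vmax ge_max /vmax !le_max lexx /=.
  by rewrite (Tm a0 aF) orbT.
by move=> i; apply: le_trans (Fa i); rewrite /vmax le_max lexx orbT.
Qed.

Lemma decay_iter a n : nonneg a -> vle (T a) a -> vle (iter n.+1 T a) (iter n T a).
Proof.
by move=> a0 Ta; elim: n => //= n IH; apply: Tm => //; exact/T0/iter_ge0.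
Qed.

Lemma decay_iter_le a n m : nonneg a -> vle (T a) a -> (n <= m)%N ->
  vle (iter m T a) (iter n T a).
Proof.
move=> a0 Ta; elim: m => [|m IH]; first by rewrite leqn0 => /eqP ->; move=> i.
rewrite leq_eqVlt => /predU1P [->//|nm] i.
by apply: le_trans (IH nm i); exact: decay_iter.
Qed.

Hypothesis Tc : op_cont T.

(** The orbit of a decay point above [r] decreases to some [q]; continuity gives [q <= T q], hence
    [q = 0] by NJI, and the orbit of [r] lies below. *)
Lemma attract r e : 0 <= r -> 0 < e -> exists N, forall n, (N <= n)%N ->
  forall i, iter n T (fun=> r) i <= e.
Proof.
move=> r0 e0; have r0' : nonneg (fun _ : I => r) by move=> i.
have [a [ra Ta _]] := decay_point r0'; have a0 := nonneg_le r0' ra.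
pose x n := iter n T a; have x0 n : nonneg (x n) by exact: iter_ge0.
pose q i := inf (range (fun n => x n i)).
have x_inf i : has_inf (range (fun n => x n i)).
  by split; [exists (x 0%N i), 0%N | exists 0 => _ [n _ <-]; exact: x0].
have q_le n i : q i <= x n i by apply: ge_inf; [have [] := x_inf i | exists n].
have q0 : nonneg q.
  by move=> i; apply: lb_le_inf; [have [] := x_inf i | move=> _ [n _ <-]; exact: x0].
have q_lim d : 0 < d -> exists N, forall n, (N <= n)%N -> forall i, x n i <= q i + d.
  move=> d0; apply: fin_eventually => i.
  have [_ [N _ <-] HN] := inf_adherent d0 (x_inf i).
  by exists N => n Nn; rewrite (le_trans (decay_iter_le a0 Ta Nn i)) // ltW.
have qT : vle q (T q).
  move=> i; apply: le_eps => d d0; have [d' d'0 Hd'] := Tc q0 d0.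
  have [N HN] := q_lim d' d'0.
  have xq j : `|x N j - q j| <= d'.
    by rewrite ger0_norm ?subr_ge0 // lerBlDl; exact: HN.
  by have := Hd' _ (x0 N) xq i; have := q_le N.+1 i; rewrite ler_norml /=; lra.
have qz i : q i = 0.
  apply: contrapT => /eqP qi; apply: (@MBI_NJI _ _ T _ q) => //; last by split=> //; exists i.
  by exists phi.
have [N HN] := q_lim e e0; exists N => n Nn i.
have := HN n Nn i; rewrite qz add0r; apply: le_trans.
exact: iter_mono.
Qed.

(** An orbit stays below a decay point above its start, which gives boundedness and stability;
    [attract] gives attractivity, and [KL_majorant] merges them. *)
Lemma MBI_UGAS : UGAS T.
Proof.
have [phiK' _] := phiK.
have bound s n : nonneg s -> vnorm (iter n T s) <= phi (vnorm s).
  move=> s0; have [a [sa Ta av]] := decay_point s0; apply: le_trans av.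
  apply: vnorm_mono; first exact: iter_ge0.
  move=> i; apply: le_trans (iter_mono n T0 Tm s0 sa i) _.
  exact: (@decay_iter_le a 0 n (nonneg_le s0 sa) Ta).
pose P x n y := exists s, [/\ nonneg s, x = vnorm s & y = vnorm (iter n T s)].
have [||||beta bK [_ Hb]] := @KL_majorant R P.
- by move=> x n y [s [_ -> ->]]; rewrite !vnorm_ge0.
- move=> r; exists (phi (Num.max 0 r)) => x n y [s [s0 -> ->]] sr.
  rewrite (le_trans (bound s n s0)) // K_le ?vnorm_ge0 // le_max sr orbT //.
- move=> e e0; have [d d0 Hd] := K_small phiK' e0.
  exists d => // x n y [s [s0 -> ->]] sd; rewrite (le_trans (bound s n s0)) //.
  by rewrite Hd // vnorm_ge0.
- move=> r e e0; have r0 : 0 <= Num.max 0 r by rewrite le_max lexx.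
  have [N HN] := attract r0 e0; exists N => x n y [s [s0 -> ->]] sr Nn.
  apply: vnorm_le_nonneg; [exact: ltW|exact: iter_ge0|move=> i].
  apply: le_trans (HN n Nn i); apply: iter_mono => // j.
  by rewrite (le_trans (le_vnorm s j)) // le_max sr orbT.
by exists beta => // s s0 n; apply: Hb; exists s.
Qed.

End MBI.

(** * A bi-infinite chain of decay from 0 to infinity *)

Section DecayChain.
Context {R : realType} {I : finType}.
Implicit Types (s t : I -> R).
Local Open Scope classical_set_scope.
Variables (i0 : I) (T : (I -> R) -> I -> R) (phi eta : R -> R).
Hypothesis T0 : op_ge0 T.
Hypothesis Tm : op_mono T.
Hypothesis Tc : op_cont T.
Hypothesis phiK : classKinf phi.
Hypothesis T_MBI : forall s b, nonneg s -> nonneg b ->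
  vle s (vmax b (T s)) -> vnorm s <= phi (vnorm b).
Hypothesis etaK : classKinf eta.
Hypothesis T_low : forall s i, nonneg s -> eta (vnorm s) <= T s i.

(** By [T_low] and the unboundedness of [eta], large vectors have large images; this is used
    contrapositively [n] times. *)
Let iter_coercive n C : exists B, forall s, nonneg s ->
  vnorm (iter n T s) <= C -> vnorm s <= B.
Proof.
elim: n C => [|n IH] C; first by exists C.
have [r r0 Hr] := Kinf_large (C + 1) etaK; have [B HB] := IH r.
exists B => s s0 sC; apply: HB => //; rewrite leNgt; apply/negP => rv.
have [eK _] := etaK; have it0 := iter_ge0 n T0 s0.
have := T_low i0 it0; have := K_le eK (ltW r0) (ltW rv).
have := le_vnorm (iter n.+1 T s) i0; rewrite /=; move: sC => /=; lra.
Qed.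

(* [u k] is the lower limit, as [m] grows, of the [k]-th point before the first one of
   norm at most 1 on the orbit of a decay point [a m >= m]. *)
Lemma up_chain : exists u : nat -> I -> R,
  [/\ forall k, vle (u k) (u k.+1), forall k, vle (T (u k.+1)) (u k),
      forall i, 0 < u 0%N i &
      forall C, exists K, forall k, (K <= k)%N -> forall i, C <= u k i].
Proof.
have [eK _] := etaK.
have /choice [a Ha] : forall m : nat, exists a, vle (fun=> m%:R) a /\ vle (T a) a.
  move=> m; have m0 : nonneg (fun _ : I => m%:R : R) by [].
  by have [a [ma Ta _]] := decay_point Tm T_MBI m0; exists a.
have Ta m : vle (T (a m)) (a m) by case: (Ha m).
have am m i : m%:R <= a m i by case: (Ha m) => /(_ i).
have a0 m : nonneg (a m) by move=> i; exact: le_trans (am m i).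
have it0 n m : nonneg (iter n T (a m)) by exact: iter_ge0.
(* [h m] is the time of first entrance into the unit ball. *)
have /choice [h Hh] : forall m, exists n, vnorm (iter n T (a m)) <= 1 /\
    forall n', (n' < n)%N -> 1 < vnorm (iter n' T (a m)).
  move=> m; have ex : exists n, vnorm (iter n T (a m)) <= 1.
    have [N HN] := attract T0 Tm phiK T_MBI Tc (vnorm_ge0 (a m)) ltr01.
    exists N; apply: vnorm_le_nonneg => // i; apply: le_trans (HN N (leqnn N) i).
    by apply: iter_mono => // j; exact: le_vnorm.
  case: (ex_minnP ex) => n Hn Hmin; exists n; split=> // n' n'n.
  by rewrite ltNge; apply/negP => /Hmin; rewrite leqNgt n'n.
(* A start that reaches the unit ball within [k] steps is bounded by [iter_coercive], whereas
   [a m >= m]. *)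
have h_large k : exists N, forall m, (N <= m)%N -> (k < h m)%N.
  have [B HB] := iter_coercive k 1; exists (Num.bound `|B|).+1 => m Bm.
  rewrite ltnNge; apply/negP => hk.
  have vB : vnorm (a m) <= B.
    apply: HB => //; have [h1 _] := Hh m; apply: le_trans h1.
    by apply: vnorm_mono => // i; exact: (decay_iter_le T0 Tm).
  have : m%:R <= B by rewrite (le_trans (am m i0)) // (le_trans (le_vnorm _ _)).
  apply/negP; rewrite -ltNge (le_lt_trans (ler_norm B)) //.
  by rewrite (lt_le_trans (archi_boundP (normr_ge0 B))) // ler_nat ltnW.
(* Truncated subtraction gives [q k m = a m] for [k > h m], so [q] is monotone in [k] without
   restriction. *)
pose q k m := iter (h m - k) T (a m).
have q_ge0 k m : nonneg (q k m) by exact: it0.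
have q_mono k m : vle (q k m) (q k.+1 m).
  by apply: (decay_iter_le T0 Tm) => //; rewrite leq_sub2l.
have q_mono0 k m : vle (q 0%N m) (q k m).
  by apply: (decay_iter_le T0 Tm) => //; rewrite leq_sub2l.
have q_step k m : (k < h m)%N -> T (q k.+1 m) = q k m.
  by move=> km; rewrite /q -[LHS]/(iter (h m - k.+1).+1 T (a m)) -subSn.
have q_iter k m : (k <= h m)%N -> iter k T (q k m) = q 0%N m.
  by move=> km; rewrite /q -iterD subnKC // subn0.
(* The point just before entrance has norm above 1, so by [T_low] its image [q 0 m] is at least
   [eta 1] in every coordinate. *)
have q_low k m i : (0 < h m)%N -> eta 1 <= q k m i.
  move=> hm; apply: le_trans (q_mono0 k m i); rewrite -q_step // -/(q 1%N m).
  apply: le_trans (T_low i (q_ge0 1%N m)); rewrite K_le // ltW //.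
  by have [_ +] := Hh m; apply; rewrite subn1 prednK.
have q_up k : exists B, forall m i, (k <= h m)%N -> q k m i <= B.
  have [B HB] := iter_coercive k 1; exists B => m i km.
  rewrite (le_trans (le_vnorm _ _)) // HB // q_iter // /q subn0.
  by have [] := Hh m.
(* The eventual lower bounds of [q k m i] in [m]; their supremum is the lower limit. *)
pose U k i : set R := [set x | exists N, forall m, (N <= m)%N -> x <= q k m i].
have U_low k i : U k i (eta 1).
  by have [N HN] := h_large 0%N; exists N => m /HN; exact: q_low.
have U_sup k i : has_sup (U k i).
  split; first by exists (eta 1).
  have [B HB] := q_up k; have [N HN] := h_large k; exists B => x [N' HN'].
  apply: le_trans (HN' (N + N')%N (leq_addl _ _)) _.
  by apply: HB; rewrite ltnW // HN // leq_addr.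
pose u k i := sup (U k i).
have u_ge k i x : U k i x -> x <= u k i by exact: sup_upper_bound.
have u_adh k d : 0 < d -> exists N, forall m, (N <= m)%N -> forall i, u k i - d <= q k m i.
  move=> d0; apply: fin_eventually => i.
  have [x [N HN] ux] := sup_adherent d0 (U_sup k i).
  by exists N => m /HN; exact/le_trans/ltW.
have eta1 : 0 < eta 1 by exact: K_gt0.
have u_gt0 k i : 0 < u k i by apply: lt_le_trans eta1 _; exact: u_ge.
have u0 k : nonneg (u k) by move=> i; exact: ltW.
exists u; split=> // [k i|k i|C].
- apply: ge_sup; first by exists (eta 1).
  by move=> x [N HN]; apply: u_ge; exists N => m /HN /le_trans; apply; exact: q_mono.
- apply: le_eps => e e0; have [d d0 Hd] := Tc (u0 k.+1) e0.
  (* A nonnegative point close to [u k.+1] and below [q k.+1 m] for all large [m], so that [T w] is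
     eventually below [q k m]. *)
  pose w j := Num.max 0 (u k.+1 j - d).
  have w0 : nonneg w by move=> j; rewrite /w le_max lexx.
  have wu j : `|w j - u k.+1 j| <= d.
    by rewrite /w ler_norml /Num.max; have := u0 k.+1 j; case: ltP; lra.
  have := Hd w w0 wu i; rewrite ler_norml => Tw.
  suff : T w i <= u k i by lra.
  have [N HN] := u_adh k.+1 d d0; have [N' HN'] := h_large k.
  apply: u_ge; exists (N + N')%N => m Nm; rewrite -q_step; last first.
    by apply: HN'; exact: leq_trans (leq_addl _ _) Nm.
  apply: Tm => // j; rewrite /w ge_max q_ge0 HN //; exact: leq_trans (leq_addr _ _) Nm.
- have [r r0 Hr] := Kinf_large C etaK.
  have [|K HK] := attract T0 Tm phiK T_MBI Tc (ltW r0) (e := eta 1 / 2).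
    by rewrite divr_gt0.
  (* Either [q k.+1 m] has norm above [r] and [T_low] makes its image at least [C], or [k.+1] steps
     from inside that ball end below [eta 1 / 2], against [q_low]. *)
  exists K => k Kk i; apply: u_ge; have [N HN] := h_large k; exists N => m /HN km.
  have [rv|vr] := ltP r (vnorm (q k.+1 m)).
    rewrite -q_step // (le_trans Hr) // (le_trans _ (T_low i (q_ge0 k.+1 m))) //.
    by rewrite K_le // ltW.
  have : q 0%N m i <= eta 1 / 2.
    rewrite -(q_iter k.+1) // (le_trans _ (HK k.+1 (leqW Kk) i)) //.
    by apply: iter_mono => // j; exact: le_trans (le_vnorm _ j) vr.
  by have := @q_low 0%N m i (leq_ltn_trans (leq0n k) km); lra.
Qed.

(** Nonnegative indices carry [up_chain]; negative ones carry the orbit of [u 0], which tends to 0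
    by [attract] and stays positive by [T_low]. As [Negz n] is [- n.+1], it receives the iterate
    [n.+1]. *)
Lemma decay_chain : exists p : int -> I -> R,
  [/\ forall k, vle (p k) (p (k + 1)), forall k, vle (T (p (k + 1))) (p k),
      forall k i, 0 < p k i,
      forall C, exists K : nat, forall k : int, K%:Z <= k -> forall i, C <= p k i &
      forall e, 0 < e -> exists K : nat, forall k : int, k <= - K%:Z ->
        forall i, p k i <= e].
Proof.
have [eK _] := etaK.
have [u [u_mono Tu u_gt0 u_large]] := up_chain.
have u0 : nonneg (u 0%N) by move=> i; exact: ltW.
pose p (k : int) := if k is Negz n then iter n.+1 T (u 0%N) else u `|k|%N.
have pN n : p (Negz n + 1) = iter n T (u 0%N).
  by case: n => [|n] //; rewrite NegzE (_ : - n.+2%:Z + 1 = Negz n) // NegzE; lia.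
have pP n : p (n%:Z + 1) = u n.+1 by rewrite -PoszD addn1.
have Tu0 : vle (T (u 0%N)) (u 0%N).
  move=> i; apply: le_trans (Tu 0%N i); exact: Tm.
exists p; split=> [[n|n]|[n|n]|[n|n] i|C|e e0].
- by rewrite pP; exact: u_mono.
- by rewrite pN; exact: (decay_iter T0 Tm).
- by rewrite pP; exact: Tu.
- by rewrite pN => i.
- by elim: n => [|n IH] /=; [exact: u_gt0 | apply: lt_le_trans IH _; exact: u_mono].
- rewrite /p /=; have it0 := iter_ge0 n T0 u0.
  apply: lt_le_trans (T_low i it0); apply: K_gt0 => //.
  apply: lt_le_trans (le_vnorm _ i).
  elim: n {it0} => [|n IH] /=; first exact: u_gt0.
  have it0 := iter_ge0 n T0 u0.
  apply: lt_le_trans (T_low i it0); apply: K_gt0 => //.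
  by apply: lt_le_trans IH (le_vnorm _ i).
- have [K HK] := u_large C; exists K => -[n|n] Kn i; last by lia.
  by apply: HK; lia.
- have [K HK] := attract T0 Tm phiK T_MBI Tc (vnorm_ge0 (u 0%N)) e0.
  exists K.+1 => -[n|n] kK i; first by lia.
  apply: le_trans (HK n.+1 _ i); last by lia.
  by apply: iter_mono => // j; exact: le_vnorm.
Qed.

End DecayChain.

(** * Piecewise linear interpolation with integer nodes *)

Section Interpolation.
Context {R : realType}.
Implicit Types (x y : R) (k : int).
Variable z : int -> R.

Definition interp x : R :=
  let k := Num.floor x in z k + (x - k%:~R) * (z (k + 1) - z k).

(** The formula of cell [k] remains valid at its right end, although the floor jumps to [k + 1]
    there. *)
Lemma interp_itv k x : k%:~R <= x -> x <= (k + 1)%:~R ->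
  interp x = z k + (x - k%:~R) * (z (k + 1) - z k).
Proof.
move=> kx; rewrite le_eqVlt => /predU1P [->|xk]; last first.
  by rewrite /interp (floor_def (m := k)) // kx.
by rewrite /interp (floor_def (m := k + 1)) ?lexx ?ltr_int; [rewrite intrD; ring|lia].
Qed.

Lemma interp_bounds x : (forall k, z k <= z (k + 1)) ->
  z (Num.floor x) <= interp x <= z (Num.floor x + 1).
Proof.
move=> z_mono; have := floor_itv x; rewrite intrD => /andP [fx xf].
have := z_mono (Num.floor x); rewrite /interp; nra.
Qed.

(** On one cell the slope is a gap of [z]; in general the leftmost cell is split off, by induction
    on the number of cells between [x] and [y]. *)
Lemma interp_bilip (c C : R) (N : int) x y :
  (forall k, - N <= k -> k <= N -> c <= z (k + 1) - z k <= C) ->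
  - N%:~R <= x -> x <= y -> y <= N%:~R ->
  c * (y - x) <= interp y - interp x <= C * (y - x).
Proof.
move=> zcC; rewrite -mulrNz.
have cell k (u v : R) : - N <= k -> k <= N -> k%:~R <= u -> u <= v -> v <= (k + 1)%:~R ->
    c * (v - u) <= interp v - interp u <= C * (v - u).
  move=> Nk kN ku uv vk; rewrite !(@interp_itv k) //; try exact: le_trans uv _.
    by have := zcC k Nk kN; nra.
  exact: le_trans ku uv.
have floorE (u : R) : ((Num.floor u)%:~R <= u) * (u <= (Num.floor u + 1)%:~R).
  by have /andP [? /ltW ?] := floor_itv u.
have [n] : exists n : nat, Num.floor y - Num.floor x <= n%:Z.
  by exists `|(Num.floor y - Num.floor x)%R|%N; lia.
elim: n x => [|n IH] x Hn Nx xy yN.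
  apply: (cell (Num.floor x)); rewrite ?floorE //.
  - by rewrite floor_ge_int.
  - by rewrite -(ler_int R); apply: le_trans yN; apply: le_trans xy; rewrite floorE.
  - by apply: (@le_trans _ _ (Num.floor y + 1)%:~R); rewrite ?floorE // ler_int; lia.
have NF : - N <= Num.floor x by rewrite floor_ge_int.
have FN : Num.floor x <= N.
  by rewrite -(ler_int R); apply: le_trans yN; apply: le_trans xy; rewrite floorE.
have [yk|ky] := lerP y (Num.floor x + 1)%:~R.
  by apply: (cell (Num.floor x)); rewrite ?floorE.
have h1 := cell (Num.floor x) x (Num.floor x + 1)%:~R NF FN.
have {h1} : _ := h1 (floorE x).1 (floorE x).2 (lexx _).
have : c * (y - (Num.floor x + 1)%:~R) <= interp y - interp (Num.floor x + 1)%:~R <=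
    C * (y - (Num.floor x + 1)%:~R).
  apply: IH => //; last exact: ltW.
    by rewrite intrKfloor; lia.
  by rewrite ler_int; lia.
lra.
Qed.

End Interpolation.

(** * From a strictly increasing chain to a path of strict decay *)

Section PathFromChain.
Context {R : realType} {I : finType}.
Local Open Scope classical_set_scope.
Variables (i0 : I) (G : (I -> R) -> I -> R) (rho : R -> R) (z : int -> I -> R).
Hypothesis rhoK : classKinf rho.
Hypothesis T0 : op_ge0 (Gam_rho G rho).
Hypothesis Tm : op_mono (Gam_rho G rho).
Hypothesis z_lt : forall k i, z k i < z (k + 1) i.
Hypothesis z_gt0 : forall k i, 0 < z k i.
Hypothesis Tz : forall k, vle (Gam_rho G rho (z (k + 1))) (z k).
Hypothesis z_large : forall C, exists K : nat,
  forall k : int, K%:Z <= k -> forall i, C <= z k i.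
Hypothesis z_small : forall e, 0 < e -> exists K : nat,
  forall k : int, k <= - K%:Z -> forall i, z k i <= e.

(* [r - 1 / r] maps the half-line onto the line, bi-Lipschitz on compacts. *)
Let sig (r : R) i : R :=
  if r <= 0 then 0 else interp (fun k => z k i) (r - r^-1).

Let sig0 i : sig 0 i = 0. Proof. by rewrite /sig lexx. Qed.

Let sigE r i : 0 < r -> sig r i = interp (fun k => z k i) (r - r^-1).
Proof. by move=> r0; rewrite /sig leNgt r0. Qed.

Let sig_bounds r i : 0 < r -> let k := Num.floor (r - r^-1) in
  z k i <= sig r i <= z (k + 1) i.
Proof.
by move=> r0; rewrite sigE //; apply: (interp_bounds (z := fun k => z k i)) => k; exact: ltW.
Qed.

Let sig_gt0 r i : 0 < r -> 0 < sig r i.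
Proof.
by move=> r0; have /andP [h _] := sig_bounds i r0; exact: lt_le_trans h.
Qed.

(** Only finitely many gaps occur; the shift by [N] indexes them by an ordinal type. *)
Let gaps (N : nat) : exists c C : R, [/\ 0 < c, 0 < C &
  forall i (k : int), - N%:Z <= k -> k <= N%:Z -> c <= z (k + 1) i - z k i <= C].
Proof.
pose gap (p : I * 'I_(N + N).+1) : R :=
  z ((p.2 : nat)%:Z - N%:Z + 1) p.1 - z ((p.2 : nat)%:Z - N%:Z) p.1.
have gap0 p : 0 < gap p by rewrite subr_gt0.
have [|c c0 Hc] := @fin_pos R _ (fun p x => x <= gap p).
  by move=> p; exists (gap p).
exists c, (vnorm gap + 1); split=> // [|i k Nk kN].
  by rewrite ltr_wpDl ?vnorm_ge0.
have kp : (`|(k + N%:Z)%R| < (N + N).+1)%N by lia.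
have kE : k = (Ordinal kp : nat)%:Z - N%:Z by rewrite /=; lia.
have := Hc (i, Ordinal kp) c c0 (lexx _); have := le_vnorm gap (i, Ordinal kp).
by rewrite /gap [(_, _).1]/= [(_, _).2]/= -kE; lra.
Qed.

(** On [[A, B]] the difference quotients of [r - 1 / r] lie between 1 and [1 + A^-1 * A^-1], and its
    values between [-N] and [N], where the slopes of the interpolant are controlled. *)
Let sig_bilip A B : 0 < A -> A <= B -> exists c C : R, [/\ 0 < c, c <= C &
  forall i r r', A <= r -> r <= r' -> r' <= B ->
    c * (r' - r) <= sig r' i - sig r i <= C * (r' - r)].
Proof.
move=> A0 AB; pose N := Num.bound (`|A - A^-1| + `|B - B^-1|).
have [c [C [c0 C0 Hg]]] := gaps N.
have hm (u v : R) : A <= u -> u <= v ->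
    v - u <= (v - v^-1) - (u - u^-1) <= (1 + A^-1 * A^-1) * (v - u).
  move=> Au uv; have u0 : 0 < u by lra.
  have v0 : 0 < v by lra.
  have -> : (v - v^-1) - (u - u^-1) = (1 + u^-1 * v^-1) * (v - u) by field; lra.
  have uA : u^-1 <= A^-1 by rewrite lef_pV2 ?posrE //; lra.
  have vA : v^-1 <= A^-1 by rewrite lef_pV2 ?posrE //; lra.
  have iu : 0 < u^-1 by rewrite invr_gt0.
  have iv : 0 < v^-1 by rewrite invr_gt0.
  have q0 : 0 <= u^-1 * v^-1 by rewrite mulr_ge0 ?ltW.
  have q1 : u^-1 * v^-1 <= A^-1 * A^-1 by rewrite ler_pM ?(ltW iu) ?(ltW iv).
  move: q0 q1; set q := u^-1 * v^-1; set q' := A^-1 * A^-1 => q0 q1.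
  by apply/andP; split; nra.
pose m := 1 + A^-1 * A^-1.
have iA : 0 < A^-1 by rewrite invr_gt0.
have m1 : 1 <= m by rewrite /m; nra.
(* Adding [c] secures the required order of the two constants. *)
exists c, (C * m + c); split=> // [|i r r' Ar rr' r'B]; first by nra.
rewrite !sigE; [|lra|lra].
have bN : `|A - A^-1| + `|B - B^-1| < N%:R by apply: archi_boundP; rewrite addr_ge0.
have h1 : - (N%:Z)%:~R <= r - r^-1.
  have := hm A r (lexx _) Ar; have := ler_norm (- (A - A^-1)); rewrite normrN.
  by have := normr_ge0 (B - B^-1); rewrite -pmulrn; lra.
have h2 : r' - r'^-1 <= (N%:Z)%:~R.
  have := hm r' B (le_trans Ar rr') r'B; have := ler_norm (B - B^-1).
  by have := normr_ge0 (A - A^-1); rewrite -pmulrn; lra.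
have := hm r r' Ar rr'; rewrite -/m => h3.
have h4 : r - r^-1 <= r' - r'^-1 by lra.
have := interp_bilip (z := fun k => z k i) (Hg i) h1 h4 h2.
by move: h3; set X := r' - r'^-1 - _; nra.
Qed.

Let sig_lt i r r' : 0 <= r -> r < r' -> sig r i < sig r' i.
Proof.
rewrite le_eqVlt => /predU1P [<- r'0|r0 rr']; first by rewrite sig0 sig_gt0.
have [c [C [c0 _ H]]] := sig_bilip r0 (ltW rr').
have := H i r r' (lexx _) (ltW rr') (lexx _).
have : 0 < c * (r' - r) by rewrite mulr_gt0 // subr_gt0.
lra.
Qed.

Let sig_ge0 r : 0 <= r -> nonneg (sig r).
Proof.
by rewrite le_eqVlt => /predU1P [<-|r0] i; [rewrite sig0 | exact/ltW/sig_gt0].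
Qed.

Let sig_K i : classKinf (fun r => sig r i).
Proof.
split; [split=> //|].
- move=> r; rewrite le_eqVlt => /predU1P [<-|r0] e e0.
    have [|K HK] := @z_small (e / 2); first lra.
    have K0 : 0 <= K%:R :> R by [].
    (* For such [y] the value [y - y^-1] lies below [-K], so even the upper node of its cell has
       index at most [-K]. *)
    exists (K%:R + 2)^-1 => [|y]; first by rewrite invr_gt0; lra.
    rewrite le_eqVlt => /predU1P [<-|y0]; first by rewrite sig0 subrr normr0.
    rewrite !subr0 sig0 subr0 !gtr0_norm ?sig_gt0 // => yK.
    have /andP [_ h] := sig_bounds i y0; apply: le_lt_trans h _.
    suff : Num.floor (y - y^-1) + 1 <= - K%:Z by move=> kK; have := HK _ kK i; lra.
    have K2 : 0 < K%:R + 2 :> R by lra.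
    have y1 : y * (K%:R + 2) < 1 by rewrite -(ltr_pdivlMr _ _ K2) mul1r.
    have yi : K%:R + 2 < y^-1 by rewrite -[y^-1]mul1r (ltr_pdivlMr _ _ y0) mulrC.
    suff : Num.floor (y - y^-1) < - K%:Z by lia.
    rewrite floor_lt_int mulrNz -pmulrn; nra.
  have [||c [C [c0 cC H]]] := @sig_bilip (r / 2) (2 * r); [lra|lra|].
  have C0 : 0 < C by lra.
  exists (Num.min (r / 2) (e / (C + 1))) => [|y y0].
    by rewrite lt_min !divr_gt0 //; lra.
  rewrite lt_min => /andP [yr ye].
  have yr' : r / 2 <= y /\ y <= 2 * r by move: yr; rewrite ltr_norml; lra.
  suff : `|sig y i - sig r i| <= C * `|y - r|.
    have : C * (e / (C + 1)) < e by rewrite mulrCA gtr_pMr // ltr_pdivrMr; lra.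
    have : C * `|y - r| < C * (e / (C + 1)) by rewrite ltr_pM2l.
    lra.
  have [yr1|ry1] := lerP y r.
    have /andP [h1 h2] := H i y r yr'.1 yr1 ltac:(lra).
    have h3 : 0 <= c * (r - y) by rewrite mulr_ge0 ?(ltW c0) // subr_ge0.
    by rewrite !ler0_norm; lra.
  have /andP [h1 h2] := H i r y ltac:(lra) (ltW ry1) yr'.2.
  have h3 : 0 <= c * (y - r) by rewrite mulr_ge0 ?(ltW c0) // subr_ge0 ltW.
  by rewrite !ger0_norm //; lra.
- by move=> x y; exact: sig_lt.
move=> M; have [K HK] := z_large (M + 1).
have K0 : 0 <= K%:R :> R by [].
exists (K%:R + 1); first by lra.
have /andP [h _] := @sig_bounds (K%:R + 1) i ltac:(lra).
apply: lt_le_trans h.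
suff kK : K%:Z <= Num.floor (K%:R + 1 - (K%:R + 1 : R)^-1).
  by have := HK _ kK i; lra.
rewrite floor_ge_int -pmulrn.
by have : (K%:R + 1 : R)^-1 <= 1; [rewrite invf_le1; lra | lra].
Qed.

Let sig_decay r : 0 <= r -> vle (Gam_rho G rho (sig r)) (sig r).
Proof.
rewrite le_eqVlt => /predU1P [<-|r0] i.
  (* At [r = 0] the image of the zero vector lies below every node of the chain, hence below every
     [e]. *)
  rewrite sig0; apply: le_eps => e e0; rewrite add0r.
  have [K HK] := z_small e0; apply: le_trans (HK _ (lexx _) i).
  by apply: le_trans (Tz (- K%:Z) i); apply: Tm => j; rewrite sig0 // ltW.
have /andP [h _] := sig_bounds i r0; apply: le_trans h; apply: le_trans (Tz _ i).
apply: Tm; first exact/sig_ge0/ltW.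
by move=> j; have /andP [] := sig_bounds j r0.
Qed.

(** Closedness leaves a ball around 0 outside [K], whose radius is [A]; boundedness gives [B]. *)
Let compact_itv (K : set R) : compact K -> K `<=` [set x | 0 < x] ->
  exists A B, [/\ 0 < A, A <= B & forall x, K x -> A <= x <= B].
Proof.
move=> Kc Kpos; have [M [_ HM]] := compact_bounded Kc.
have : nbhs (0 : R) (~` K).
  apply: open_nbhs_nbhs; split; last by move=> /Kpos /=; rewrite ltxx.
  by apply: closed_openC; apply: compact_closed Kc; exact: norm_hausdorff.
move=> /nbhs_ballP [A /= A0 HA].
exists A, (`|M| + 1 + A); split=> // [|x Kx]; first by have := normr_ge0 M; lra.
have x0 : 0 < x by exact: Kpos.
apply/andP; split.
  rewrite leNgt; apply/negP => xA; apply: (HA x) Kx.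
  by rewrite /ball /= sub0r normrN gtr0_norm.
have : `|x| <= `|M| + 1 by apply: (HM _ _ x Kx); have := ler_norm M; lra.
by have := ler_norm x; lra.
Qed.

Lemma chain_path : exists sig, strict_decay_path G sig.
Proof.
pose phimin r := \big[Num.min/sig r i0]_i sig r i.
pose phimax r := \big[Num.max/sig r i0]_i sig r i.
have minK : classKinf phimin by exact: (@Kinf_bigmin R I (fun i r => sig r i)).
have maxK : classKinf phimax by exact: (@Kinf_bigmax R I (fun i r => sig r i)).
have bnd r i : phimin r <= sig r i <= phimax r by rewrite bigmin_le le_bigmax.
exists sig; split=> //; first by exists rho.
  by exists phimin, phimax; split.
move=> K Kc Kpos; have [A [B [A0 AB KAB]]] := compact_itv Kc Kpos.
have [maxK' _] := maxK; have [minK' _] := minK.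
have [|a a0 Ha] := K_small maxK' (e := A / 2); first lra.
have [b b0 Hb] := Kinf_large (B + 1) minK.
(* Parameters with values in [K] lie in one compact interval for all [i]: [phimax] is small below
   [a] and [phimin] large above [b]. Inverting [sig_bilip] on it gives the constants [C^-1] and
   [c^-1]. *)
have t_itv i t : 0 <= t -> K (sig t i) -> a <= t <= a + b.
  move=> t0 /KAB /andP [h1 h2]; have /andP [h3 h4] := bnd t i; apply/andP; split.
    by rewrite leNgt; apply/negP => ta; have := Ha t t0 (ltW ta); lra.
  rewrite leNgt; apply/negP => tb.
  by have := K_le minK' (ltW b0) (y := t) ltac:(lra); lra.
have [||c [C [c0 cC H]]] := @sig_bilip a (a + b); [lra|lra|].
have C0 : 0 < C by lra.
have key i s t : 0 <= s -> 0 <= t -> K (sig s i) -> K (sig t i) -> s <= t ->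
    C^-1 * `|sig s i - sig t i| <= `|s - t| <= c^-1 * `|sig s i - sig t i|.
  move=> s0 t0 /(t_itv i s s0)/andP [as_ _] /(t_itv i t t0)/andP [_ tb] st.
  have := H i s t as_ st tb => /andP [h1 h2].
  have h3 : 0 <= c * (t - s) by rewrite mulr_ge0 ?(ltW c0) // subr_ge0.
  rewrite !ler0_norm; [|lra|lra].
  by rewrite ler_pdivrMl // ler_pdivlMl //; apply/andP; split; lra.
exists C^-1, c^-1; split=> [||i r1 r2 t1 t2 K1 K2 t10 t20 E1 E2].
- by rewrite invr_gt0.
- by rewrite lef_pV2 ?posrE.
subst r1 r2; have [t12|/ltW t21] := leP t1 t2; first exact: key.
by rewrite (distrC (sig t1 i)) (distrC t1); exact: key.
Qed.

End PathFromChain.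

(** * From MBI to a path of strict decay *)

Section PathFromMBI.
Context {R : realType} {I : finType}.
Implicit Types (s t b : I -> R) (T G : (I -> R) -> I -> R).

Definition lift_op (eta : R -> R) T s : I -> R :=
  fun i => Num.max (T s i) (eta (vnorm s)).

Lemma lift_op_ge0 eta T : op_ge0 T -> op_ge0 (lift_op eta T).
Proof. by move=> T0 s s0 i; rewrite le_max T0. Qed.

Lemma lift_op_mono eta T : classK eta -> op_mono T -> op_mono (lift_op eta T).
Proof.
move=> eK Tm s t s0 st i; rewrite ge_max !le_max (Tm s t s0 st) /=.
by rewrite K_le ?orbT ?vnorm_ge0 // vnorm_mono.
Qed.

Lemma lift_op_cont eta T : classK eta -> op_cont T -> op_cont (lift_op eta T).
Proof.
move=> [ec _ _] Tc s s0 e e0; have [d d0 Hd] := Tc s s0 e e0.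
have [d' d'0 Hd'] := ec _ (vnorm_ge0 s) e e0.
exists (Num.min d (d' / 2)) => [|t t0 ts i]; first by rewrite lt_min d0 divr_gt0.
have ts1 j : `|t j - s j| <= d by have := ts j; rewrite le_min => /andP [].
have ts2 j : `|t j - s j| <= d' / 2 by have := ts j; rewrite le_min => /andP [].
have := Hd t t0 ts1 i.
have : `|eta (vnorm t) - eta (vnorm s)| < e.
  apply: Hd'; first exact: vnorm_ge0.
  have : `|vnorm t - vnorm s| <= d' / 2 by apply: vnorm_lip => //; rewrite divr_ge0 // ltW.
  lra.
rewrite ltr_norml !ler_norml /lift_op; move: (eta _) (eta _) (T t i) (T s i).
by move=> a a' b b'; rewrite /Num.max; case: ifP => ?; case: ifP => ?; lra.
Qed.

(* A perturbation of size [eta (vnorm s)] is absorbed by the bound [phi] as soon as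
   [phi (eta x) <= x / 2]. *)
Lemma lift_op_MBI phi eta T :
  classK phi -> classK eta -> (forall x, 0 <= x -> phi (eta x) = x / 2) ->
  (forall s b, nonneg s -> nonneg b -> vle s (vmax b (T s)) ->
     vnorm s <= phi (vnorm b)) ->
  forall s b, nonneg s -> nonneg b -> vle s (vmax b (lift_op eta T s)) ->
    vnorm s <= phi (vnorm b).
Proof.
move=> fK eK fe HT s b s0 b0 sb; have v0 := vnorm_ge0 s.
have ev0 := K_ge0 eK v0.
pose b' i := Num.max (b i) (eta (vnorm s)).
have b'0 : nonneg b' by move=> i; rewrite le_max b0.
have /(HT s b' s0 b'0) : vle s (vmax b' (T s)).
  move=> i; have := sb i; rewrite /vmax /lift_op /b' !le_max.
  by case/or3P => ->; rewrite ?orbT.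
have [eb|be] := leP (eta (vnorm s)) (vnorm b).
  move/le_trans; apply; apply: K_le => //; first exact: vnorm_ge0.
  apply: vnorm_le_nonneg => // [|i]; first exact: vnorm_ge0.
  by rewrite ge_max le_vnorm.
have : phi (vnorm b') <= vnorm s / 2.
  rewrite -fe //; apply: K_le => //; first exact: vnorm_ge0.
  apply: vnorm_le_nonneg => // i; rewrite ge_max lexx andbT.
  exact: le_trans (le_vnorm b i) (ltW be).
by have := K_ge0 fK (vnorm_ge0 b); lra.
Qed.

(** A strictly increasing map of the integers into the open unit interval, with [theta (-1) = 1/3]
    and [theta 0 = 1/2]. *)
Let theta (k : int) : R :=
  match k with Posz n => 1 - n.+2%:R^-1 | Negz n => n.+3%:R^-1 end.

Let theta_itv k : 0 < theta k < 1.
Proof.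
have inv n : (0 < n.+2%:R^-1 :> R) && (n.+2%:R^-1 < 1 :> R).
  by rewrite invr_gt0 invf_lt1 ?ltr0n ?ltr1n.
by case: k => n /=; [have := inv n | have := inv n.+1]; set x := _^-1; lra.
Qed.

Let theta_lt k : theta k < theta (k + 1).
Proof.
have inv n : n.+3%:R^-1 < n.+2%:R^-1 :> R by rewrite ltf_pV2 ?posrE ?ltr0n // ltr_nat.
case: k => [n|[|n]].
- by rewrite -PoszD addn1 /= ltrD2l ltrN2.
- by rewrite (_ : Negz 0 + 1 = 0%N) //=; lra.
- by rewrite (_ : Negz n.+1 + 1 = Negz n) ?NegzE; [exact: inv n.+1 | lia].
Qed.

Let theta_ge k : 0 <= k -> 2^-1 <= theta k.
Proof.
case: k => n //= _; have : n.+2%:R^-1 <= 2^-1 :> R; last by set x := _%:R^-1; lra.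
by rewrite lef_pV2 ?posrE ?ltr0n // ler_nat.
Qed.

(* The points of the chain may have equal coordinates; convex combinations with the
   strictly smaller points [Gam_rho G (rho / 2) (p (k + 1))], with weights increasing
   in [k], separate them without destroying the decay. *)
Lemma MBI_path (i0 : I) G rho : op_ge0 G -> op_mono G -> op_cont G ->
  classKinf rho -> oplus_MBI (Gam_rho G rho) -> exists sig, strict_decay_path G sig.
Proof.
move=> G0 Gm Gc rhoK [phi phiK HT]; have [rK _] := rhoK; have [fK _] := phiK.
have [h hK fh] := Kinf_inverse phiK.
(* Chosen so that [phi (eta x) = x / 2], as [lift_op_MBI] demands. *)
pose eta x := h (x / 2); have etaK : classKinf eta by exact: Kinf_scale.
have [eK _] := etaK.
have fe x : 0 <= x -> phi (eta x) = x / 2 by move=> x0; rewrite fh // divr_ge0.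
have [p [p_mono Tp p_gt0 p_large p_small]] :=
  decay_chain i0 (lift_op_ge0 eta (Gam_rho_ge0 rK G0))
    (lift_op_mono eK (Gam_rho_mono rK G0 Gm))
    (lift_op_cont eK (Gam_rho_cont rK G0 Gc)) phiK (lift_op_MBI fK eK fe HT) etaK
    (fun s i _ => ltac:(by rewrite /lift_op le_max lexx orbT)).
have rho2K : classKinf (fun x => rho x / 2) by exact: Kinf_half.
have [r2K _] := rho2K.
pose T2 := Gam_rho G (fun x => rho x / 2).
have T20 : op_ge0 T2 by exact: Gam_rho_ge0.
have T2m : op_mono T2 by exact: Gam_rho_mono.
have p0 k : nonneg (p k) by move=> i; exact: ltW.
(* Strictness comes from halving [rho] where [G] is positive, and from [p k i > 0] where it
   vanishes. *)
have T2p k i : T2 (p (k + 1)) i < p k i.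
  have := Tp k i; rewrite /lift_op ge_max => /andP [+ _].
  rewrite /T2 /Gam_rho; have := G0 _ (p0 (k + 1)) i.
  rewrite le_eqVlt => /predU1P [<-|Gpos]; last by have := K_gt0 rK Gpos; lra.
  by have [_ _ ->] := rK; have := p_gt0 k i; lra.
have T2p_mono k i : T2 (p (k + 1)) i <= T2 (p (k + 1 + 1)) i by exact: T2m.
pose z k i := (1 - theta k) * T2 (p (k + 1)) i + theta k * p k i.
have z_ge k i : T2 (p (k + 1)) i <= z k i.
  by have := T2p k i; have := theta_itv k; rewrite /z; nra.
have z_le k i : z k i <= p k i.
  by have := T2p k i; have := theta_itv k; rewrite /z; nra.
have z_gt0 k i : 0 < z k i.
  have := T20 _ (p0 (k + 1)) i; have := p_gt0 k i; have := theta_itv k.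
  by rewrite /z; nra.
apply: (@chain_path R I i0 G _ z rho2K) => // [k i|k i|C|e e0].
- have := T2p k i; have := T2p_mono k i; have := p_mono k i.
  have := theta_itv k; have := theta_itv (k + 1); have := theta_lt k; rewrite /z.
  set a := T2 _ i; set a' := T2 _ i; set c := p k i; set c' := p _ i.
  set u := theta k; set v := theta _ => uv vI uI cc' aa' ac.
  have : (1 - v) * a + v * c <= (1 - v) * a' + v * c' by nra.
  have : 0 < (v - u) * (c - a) by rewrite mulr_gt0 ?subr_gt0.
  lra.
(* The decay survives because [T2 (z (k + 1)) <= T2 (p (k + 1)) <= z k]. *)
- apply: le_trans (z_ge k i); apply: T2m => [j|j]; first exact: ltW.
  exact: z_le.
(* For [k >= 0] the weight is at least one half, so [z k] is at least half of [p k]; hence the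
   factor 2. *)
- have [K HK] := p_large (2 * Num.max 0 C); exists K => k Kk i.
  have := HK k Kk i; have := T20 _ (p0 (k + 1)) i; have := theta_itv k.
  have /theta_ge : 0 <= k by lia.
  have : 0 <= Num.max 0 C by rewrite le_max lexx.
  have : C <= Num.max 0 C by rewrite le_max lexx orbT.
  by rewrite /z; nra.
- have [K HK] := p_small e e0; exists K => k Kk i.
  exact: le_trans (z_le k i) (HK k Kk i).
Qed.

End PathFromMBI.

(** * The equivalences *)

Unset Implicit Arguments.
Set Strict Implicit.

Theorem theorem4p15 (R : realType) (I : finType) (i0 : I)
  (Ii : I -> {set I}) (g : I -> I -> R -> R) (mu : I -> (I -> R) -> \bar R) :
  is_gain_operator Ii g mu ->
  (forall i, unif_cont (mu i)) ->
  [/\ (exists2 rho, classKinf rho & NJI (Gam_rho (Gam Ii g mu) rho)) <->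
        (exists2 rho, classKinf rho & uNJI Ii (Gam_rho (Gam Ii g mu) rho)),
      (exists2 rho, classKinf rho & NJI (Gam_rho (Gam Ii g mu) rho)) <->
        (exists2 rho, classKinf rho & oplus_MBI (Gam_rho (Gam Ii g mu) rho)),
      (exists2 rho, classKinf rho & NJI (Gam_rho (Gam Ii g mu) rho)) <->
        (exists sig, strict_decay_path (Gam Ii g mu) sig) &
      (exists2 rho, classKinf rho & NJI (Gam_rho (Gam Ii g mu) rho)) <->
        (exists2 rho, classKinf rho & UGAS (Gam_rho (Gam Ii g mu) rho))].
Proof.
move=> gain uc.
have G0 := Gam_ge0 gain; have Gm := Gam_mono gain; have Gc := Gam_cont gain uc.
(* NJI is the hub: each implication out of it passes through MBI, and each of the other conditions
   leads back to it directly. *)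
have MBI : (exists2 rho, classKinf rho & NJI (Gam_rho (Gam Ii g mu) rho)) ->
    exists2 rho, classKinf rho & oplus_MBI (Gam_rho (Gam Ii g mu) rho).
  move=> [rho rK HN]; exists (fun x => rho (x / 2) / 2).
    exact/(Kinf_half (f := fun x => rho (x / 2)))/Kinf_scale.
  apply: NJI_MBI rK HN => //; first exact: Gam_trunc_bounded.
  exact: Gam_trunc_small.
split; split.
- move=> /MBI [rho rK HM]; exists rho => //; have [rK' _] := rK.
  apply: MBI_uNJI HM; first exact: Gam_rho_ge0.
  by move=> s t i st; rewrite /Gam_rho (Gam_local g mu st).
- by move=> [rho rK /uNJI_NJI HN]; exists rho.
- exact: MBI.
- by move=> [rho rK /MBI_NJI HN]; exists rho.
- by move=> /MBI [rho rK HM]; exact: MBI_path HM.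
- by move=> [sig]; exact: path_NJI.
- move=> /MBI [rho rK [phi phiK HM]]; exists rho => //; have [rK' _] := rK.
  apply: MBI_UGAS phiK HM _; [exact: Gam_rho_ge0|exact: Gam_rho_mono|exact: Gam_rho_cont].
- move=> [rho rK HU]; exists rho => //; have [rK' _] := rK.
  by apply: UGAS_NJI HU; [exact: Gam_rho_ge0|exact: Gam_rho_mono].
Qed.
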